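(* Let $G$ be a quasi-banana graph with first gonality $\mathrm{gon}_1(G)=k$. Then the following hold. \begin{enumerate} \item The genus of $G$ is $g=\binom{k}{2}$. \item The gonality sequence of $G$ is given, for integers $r\ge 1$, by \[ \mathrm{gon}_r(G)=\begin{cases} l(k+1)-h & \text{if } r<g,\\ g+r & \text{if } r\ge g,\end{cases} \] where (for $r<g$) $1\le l\le k-2$ and $0\le h\le l$ are the uniquely determined integers such that $r=\frac{l(l+3)}{2}-h$. \item If $k\ne 2$, all divisors realising the second gonality of $G$ are linearly equivalent. \item Let $D$ be a divisor realising the second gonality of $G$. Then, for every integer $l$ such that $1\le l\le k$, the divisor $l\cdot D$ realises the $\frac{l(l+3)}{2}$-th gonality of $G$. In particular, $(k-2)\cdot D$ is equivalent to the canonical divisor $K_G$. \end{enumerate}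
   Context: All graphs are finite connected loopless multigraphs. The genus of $G$ is $|E(G)|-|V(G)|+1$. A divisor on a graph $G$ is an element $D=\sum_{w\in V(G)}D(w)\cdot w$ of the free abelian group on $V(G)$; its degree is $\deg(D)=\sum_w D(w)$, and it is effective if $D(w)\ge 0$ for all $w$. Firing a vertex $v$ replaces $D$ by the divisor in which $v$ loses one chip along each incident edge and the vertex at the other end of each such edge gains one chip. Two divisors are linearly equivalent ($\sim$) if one is obtained from the other by a finite sequence of firings and inverse firings. The rank of $D$ is $-1$ if $D$ is not equivalent to an effective divisor, and otherwise is the largest integer $r\ge 0$ such that $D-E$ is equivalent to an effective divisor for every effective divisor $E$ of degree $r$. The $r$-th gonality $\mathrm{gon}_r(G)$ is the smallest degree of a divisor of rank $r$ on $G$; the gonality sequence is $\mathrm{gon}_1(G),\mathrm{gon}_2(G),\dots$. A divisor realises the $r$-th gonality if it has rank $r$ and degree $\mathrm{gon}_r(G)$. The canonical divisor is $K_G=\sum_{w\in V(G)}(\mathrm{val}(w)-2)\cdot w$, where $\mathrm{val}(w)$ is the valency of $w$. Quasi-banana graphs: let $m\ge 0$ be an integer and $N=(q_1,\dots,q_m)$ an $m$-tuple of positive integers. The graph $QB_m(N)$ has vertex set $\bigcup_{i=0}^m C_i$ (a disjoint union), where $C_0=\{u_{0,1}\}$ and $C_i=\{u_{i,j}\mid 1\le j\le q_i\}$ for $1\le i\le m$. Its edges are: (1) for each $1\le i\le m$ and distinct $1\le j,k\le q_i$, exactly one edge between $u_{i,j}$ and $u_{i,k}$; (2) for each $0\le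 i<m$ and $1\le j\le q_{i+1}$, exactly $\sum_{k=1}^{i}q_k+2$ edges between $u_{i,1}$ and $u_{i+1,j}$; (3) no other edges. A quasi-banana graph is a graph isomorphic to some $QB_m(N)$. *)

(* Defs.v *)
From Stdlib Require Import Relation_Operators.
From mathcomp Require Import all_boot all_order all_algebra.

Set Implicit Arguments.
Unset Strict Implicit.
Unset Printing Implicit Defensive.

Import Order.TTheory GRing.Theory Num.Theory.

Local Open Scope ring_scope.

(* A finite connected loopless multigraph, given by its edge multiplicities:
   [mult u v] is the number of edges between [u] and [v]. *)
Record multigraph := Multigraph {
  vertex :> finType;
  mult : vertex -> vertex -> nat;
  mult_sym : forall u v, mult u v = mult v u;
  mult_loopless : forall v, mult v v = 0%N;
  vertex_nonempty : (0 < #|vertex|)%N;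
  mult_connected : forall u v, connect (fun x y => (0 < mult x y)%N) u v }.

(* Edges carry no data besides their endpoints, so a graph isomorphism amounts
   to a bijection on vertices preserving multiplicities. *)
Definition isomorphic (G H : multigraph) : Prop :=
  exists2 f : G -> H, bijective f & forall u v, mult (f u) (f v) = mult u v.

Section Divisors.

Variable G : multigraph.

Definition valency (v : G) : nat := (\sum_(w : G) mult v w)%N.

(* Handshake: the sum counts every edge exactly twice. *)
Definition num_edges : nat := (\sum_(v : G) valency v)./2.

Definition genus : int := num_edges%:Z - #|G|%:Z + 1.

Definition divisor := {ffun G -> int}.

Definition deg (D : divisor) : int := \sum_(w : G) D w.

Definition effective (D : divisor) : Prop := forall w, 0 <= D w.

Definition canonical_divisor : divisor := [ffun w => (valency w)%:Z - 2].

Definition fire (v : G) (D : divisor) : divisor :=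
  [ffun w => if w == v then D v - (valency v)%:Z else D w + (mult v w)%:Z].

(* The equivalence closure of firing relates exactly the divisors joined by a
   finite sequence of firings and inverse firings. *)
Definition lin_equiv : divisor -> divisor -> Prop :=
  clos_refl_sym_trans divisor (fun D D' => exists v, D' = fire v D).

Definition equiv_effective (D : divisor) : Prop :=
  exists2 E : divisor, effective E & lin_equiv D E.

Definition rank_test (D : divisor) (r : nat) : Prop :=
  forall E : divisor, effective E -> deg E = r%:Z -> equiv_effective (D - E).

Definition is_rank (D : divisor) (r : int) : Prop :=
  if r is Posz n then
    [/\ equiv_effective D, rank_test D n
      & forall s : nat, rank_test D s -> (s <= n)%N]
  else r = -1 /\ ~ equiv_effective D.

(* [is_gonality r d] reads gon_r(G) = d. *)
Definition is_gonality (r : nat) (d : int) : Prop :=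
  (exists2 D : divisor, is_rank D r%:Z & deg D = d) /\
  (forall D : divisor, is_rank D r%:Z -> d <= deg D).

Definition realises_gonality (r : nat) (D : divisor) : Prop :=
  is_rank D r%:Z /\ is_gonality r (deg D).

End Divisors.

Section QuasiBanana.

Variables (m : nat) (N : m.-tuple nat).

(* [qb_size 0 = 1] is the size of C_0; for 1 <= i <= m, [qb_size i] is q_i. *)
Definition qb_size (i : nat) : nat := nth 0%N (1%N :: N) i.

(* The vertex u_{i,j} is [Tagged _ j'] in layer i, with j' = j - 1: the second
   index is shifted to start at 0. *)
Definition qb_vertex : finType := {i : 'I_m.+1 & 'I_(qb_size i)}.

Definition layer (x : qb_vertex) : nat := tag x.
Definition pos (x : qb_vertex) : nat := tagged x.

(* Number of edges when [x] is the first vertex of its layer and [y] lies in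
   the next layer, and 0 otherwise. *)
Definition qb_up (x y : qb_vertex) : nat :=
  if (pos x == 0%N) && (layer y == (layer x).+1)
  then (\sum_(1 <= k < (layer x).+1) qb_size k + 2)%N else 0%N.

Definition qb_mult (x y : qb_vertex) : nat :=
  if layer x == layer y then (x != y : nat) else (qb_up x y + qb_up y x)%N.

Lemma qb_mult_sym : forall x y, qb_mult x y = qb_mult y x.
Proof.
by move=> x y; rewrite /qb_mult eq_sym [y == x]eq_sym (addnC (qb_up x y)).
Qed.

Lemma qb_mult_loopless x : qb_mult x x = 0%N.
Proof. by rewrite /qb_mult !eqxx. Qed.

Definition qb_root : qb_vertex :=
  Tagged (fun i : 'I_m.+1 => 'I_(qb_size i)) (ord0 : 'I_(qb_size (ord0 : 'I_m.+1))).

Lemma qb_nonempty : (0 < #|qb_vertex|)%N.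
Proof. by apply/card_gt0P; exists qb_root. Qed.

Hypothesis posN : all (leq 1) N.

Lemma qb_size_gt0 i : (i <= m)%N -> (0 < qb_size i)%N.
Proof.
case: i => [|i] //= lt_im; rewrite /qb_size /=.
by apply: (allP posN); rewrite mem_nth // size_tuple.
Qed.

Lemma qb_vertex_inj x y : layer x = layer y -> pos x = pos y -> x = y.
Proof.
case: x y => i j [i' j']; rewrite /layer /pos /= => /val_inj eq_i.
by case: i' / eq_i j' => j' /val_inj ->.
Qed.

Lemma qb_mult_next x y :
  pos x = 0%N -> layer y = (layer x).+1 -> (0 < qb_mult x y)%N.
Proof.
move=> px ly; rewrite /qb_mult /qb_up ly px !eqxx /=.
by rewrite eqn_leq ltnn andbF addn2 addSn.
Qed.

Lemma qb_first i : (i <= m)%N -> exists2 x, layer x = i & pos x = 0%N.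
Proof.
move=> le_im; pose k : 'I_m.+1 := Ordinal (le_im : i < m.+1)%N.
pose j : 'I_(qb_size k) := Ordinal (qb_size_gt0 le_im).
by exists (Tagged (fun i : 'I_m.+1 => 'I_(qb_size i)) j).
Qed.

Lemma qb_mult_connected x y : connect (fun u v => (0 < qb_mult u v)%N) x y.
Proof.
have csym : connect_sym (fun u v => (0 < qb_mult u v)%N).
  by apply: sym_connect_sym => u v; rewrite qb_mult_sym.
suff root z : connect (fun u v => (0 < qb_mult u v)%N) qb_root z.
  by apply: connect_trans (root y); rewrite csym.
have [i lz] : exists i, layer z = i by exists (layer z).
elim: i => [|i IHi] in z lz *.
  rewrite (_ : z = qb_root) ?connect0 //.
  apply: qb_vertex_inj => //; have := ltn_ord (tagged z).
  by rewrite -/(pos z) -[nat_of_ord (tag z)]/(layer z) lz; case: (pos z).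
have le_im : (i <= m)%N.
  by apply: ltnW; have := ltn_ord (tag z); rewrite -/(layer z) lz ltnS.
have [x0 lx px] := qb_first le_im.
apply: connect_trans (connect1 (qb_mult_next px _)); last by rewrite lx.
by apply: IHi; rewrite lx.
Qed.

Definition QB : multigraph :=
  Multigraph qb_mult_sym qb_mult_loopless qb_nonempty qb_mult_connected.

End QuasiBanana.

Definition quasi_banana (G : multigraph) : Prop :=
  exists (m : nat) (N : m.-tuple nat) (posN : all (leq 1) N),
    isomorphic G (QB posN).

(* Main.v *)
From Stdlib Require Import Relation_Operators.
Require Import Defs.
From mathcomp Require Import all_boot all_order all_algebra.
From mathcomp Require Import zify ring.

Set Implicit Arguments.
Unset Strict Implicit.
Unset Printing Implicit Defensive.

Import Order.TTheory GRing.Theory Num.Theory.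

Local Open Scope ring_scope.

(** Write T_i for the number of vertices in layers below layer i, and call the
    first vertex of a layer its hub.  A layer meets the layers below it only
    through the hub of the previous layer, to which each of its vertices is
    joined by T_i + 1 edges.  Hence linear equivalence can be handled one layer
    at a time: firing a vertex x of layer i together with everything that hangs
    above it costs x exactly M_i = T_(i+1) + 1 chips, gives one chip to every
    vertex of layer i (x included), and sends the other T_i + 1 chips to the hub below
    ([laplacian_layers], [lin_equiv_scriptP]).

    Rank is read off orderings.  An ordering numbers the vertices layer after
    layer; let nu(x) be the number of x, except that nu = -1 at the root.  No
    divisor W <= nu is equivalent to an effective one, and every divisor has a
    representative that is nonnegative away from the root and bounded there by
    some nu.  It follows that D has rank at least r if and only if every
    representative W of D and every ordering satisfy
    sum_x max(W(x) - nu(x), 0) > r ([rank_test_cost], [cost_rank_test]).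

    Let k be the number of vertices.  The whole theorem rests on one lower bound
    and one divisor.

    - [deg_lower_bound]: a divisor of rank at least r >= C(l+1,2) has degree at
      least r + C(k,2) - C(k-l,2).  For a divisor D of smaller degree,
      [cheap_representative] finds a representative and an ordering of total
      cost at most r, starting from the top layer.  The excesses W - place of
      the vertices of a layer, listed in order, can be rotated: the first entry
      moves to the end and grows by T + 1.  Sorting the values makes this list
      drop by at most one at each step, and some rotation is balanced: its
      positive entries sum to at most l + (l-1) + ..., its negative entries to at
      most p + (p-1) + ... in absolute value, where l + p + 1 = T_(i+1).  The
      layers below then satisfy the hypothesis again, with smaller r and l.

    - [hyperplane_rank]: the divisor H with one chip at each vertex and one more
      at the root has degree k + 1, and l H has rank at least C(l+2,2) - 1 for
      l <= k.  Indeed, on each layer the numbers W - place form, with a block of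
      consecutive integers summarising the lower layers, a set of distinct
      integers of prescribed sum.  The sum of the positive parts of such a set is
      least when the integers are consecutive ([staircase_min]), and on the last
      layer this least value is C(l+2,2).

    The degree l (k+1) of l H is the lower bound for r = l(l+3)/2, and removing h
    chips from l H meets the bound for r - h.  For r >= C(k,2) the bound with
    l = k - 1 is met by any divisor of degree C(k,2) + r ([riemann]).  In
    particular the first gonality is the number of vertices.  An explicit script
    shows that (k-2) H is canonical ([canonical_hyperplane]), and the genus is
    read off its degree.  Finally, if D has rank at least 2 and degree k + 1, the
    cost argument applied to its reduced representative forces the value 1 on
    every layer above the root, from the top down ([rank2_unique]), so that D is
    equivalent to H unless k = 2; for k = 2 the genus is 1 and degrees alone
    decide. *)
(** * Divisors on an arbitrary multigraph *)

Section Multigraph.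

Variable G : multigraph.
Implicit Types (D E : divisor G) (f : G -> int) (x y v : G).

Definition laplacian f : divisor G :=
  [ffun x => \sum_y (mult x y)%:Z * (f y - f x)].

Definition point v : divisor G := [ffun x => (x == v)%:Z].

Lemma laplacianD f1 f2 :
  laplacian (fun x => f1 x + f2 x) = laplacian f1 + laplacian f2.
Proof.
apply/ffunP => x; rewrite !ffunE -big_split /=.
by apply: eq_bigr => y _; ring.
Qed.

Lemma laplacianN f : laplacian (fun x => - f x) = - laplacian f.
Proof.
apply/ffunP => x; rewrite !ffunE -sumrN; apply: eq_bigr => y _; ring.
Qed.

Lemma laplacian_sum f : laplacian f = \sum_v laplacian (point v) *~ f v.
Proof.
apply/ffunP => x; rewrite sum_ffunE !ffunE.
under [RHS]eq_bigr => v _ do rewrite ffunMzE ffunE mulrz_suml.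
rewrite exchange_big /=; apply: eq_bigr => y _.
under eq_bigr => v _ do rewrite !ffunE -mulrzr intz -mulrA.
rewrite -big_distrr /=; congr (_ * _).
under eq_bigr => v _ do rewrite mulrBl.
rewrite sumrB (bigD1 y) //= (bigD1 (P := predT) x) //= !eqxx !mul1r.
by rewrite ![in RHS]big1 ?addr0 // => v ne_v; rewrite (eq_sym _ v) (negPf ne_v) mul0r.
Qed.

Lemma fireE v D : fire v D = D + laplacian (point v).
Proof.
apply/ffunP => x; rewrite !ffunE.
under eq_bigr => y _ do rewrite !ffunE.
have [->|ne_xv] := eqVneq x v.
  congr (_ + _); rewrite /valency (bigD1 v) //= (bigD1 v (P := predT)) //=.
  rewrite mult_loopless mul0r !add0r raddf_sum /= -sumrN.
  by apply: eq_bigr => y ne_y; rewrite (negPf ne_y) sub0r mulrN mulr1.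
congr (_ + _); rewrite (bigD1 v) //= eqxx big1 ?addr0; first by rewrite mult_sym mulr1.
by move=> y ne_y; rewrite (negPf ne_y) mulr0.
Qed.

Lemma lin_equivxx D : lin_equiv D D.
Proof. exact: rst_refl. Qed.

Lemma lin_equiv_sym D E : lin_equiv D E -> lin_equiv E D.
Proof. exact: rst_sym. Qed.

Lemma lin_equiv_trans D E F : lin_equiv D E -> lin_equiv E F -> lin_equiv D F.
Proof. exact: rst_trans. Qed.

Lemma lin_equivD2r D E F : lin_equiv D E -> lin_equiv (D + F) (E + F).
Proof.
elim=> [A B [v ->]|A|A B _|A B C _ AB _].
- by apply: rst_step; exists v; rewrite !fireE addrAC.
- exact: lin_equivxx.
- exact: lin_equiv_sym.
- exact: lin_equiv_trans.
Qed.

Lemma lin_equivD D1 E1 D2 E2 :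
  lin_equiv D1 E1 -> lin_equiv D2 E2 -> lin_equiv (D1 + D2) (E1 + E2).
Proof.
move=> e1 e2; apply: (lin_equiv_trans (lin_equivD2r D2 e1)).
by rewrite ![E1 + _]addrC; apply: lin_equivD2r.
Qed.

Lemma lin_equivN D E : lin_equiv D E -> lin_equiv (- D) (- E).
Proof.
move=> /(lin_equivD2r (- D - E)) /lin_equiv_sym.
by rewrite addNKr addrCA subrr addr0.
Qed.

Lemma lin_equivMz D E (z : int) : lin_equiv D E -> lin_equiv (D *~ z) (E *~ z).
Proof.
move=> eqDE; have eqMn n : lin_equiv (D *+ n) (E *+ n).
  elim: n => [|n IHn]; first exact: lin_equivxx.
  by rewrite !mulrS; apply: lin_equivD.
by case: z => n; rewrite ?NegzE ?mulrNz -!pmulrn //; apply: lin_equivN.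
Qed.

Lemma lin_equivP D E :
  lin_equiv D E <-> exists f, E = D + laplacian f.
Proof.
split=> [|[f ->]].
  elim=> [A B [v ->]|A|A B _ [f ->]|A B C _ [f1 ->] _ [f2 ->]].
  - by exists (point v); rewrite fireE.
  - exists (fun=> 0); rewrite (_ : laplacian _ = 0) ?addr0 //.
    by apply/ffunP => x; rewrite !ffunE big1 // => y _; rewrite subrr mulr0.
  - by exists (fun x => - f x); rewrite laplacianN addrK.
  - by exists (fun x => f1 x + f2 x); rewrite laplacianD addrA.
rewrite -{1}[D]addr0 laplacian_sum; apply: lin_equivD; first exact: lin_equivxx.
elim/big_ind: _ => [|P Q eqP eqQ|v _]; first exact: lin_equivxx.
  by rewrite -{1}[0]addr0; apply: lin_equivD.
rewrite -(mul0rz _ (f v)); apply: lin_equivMz.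
by apply: rst_step; exists v; rewrite fireE add0r.
Qed.

Lemma degD D E : deg (D + E) = deg D + deg E.
Proof. by rewrite /deg -big_split; apply: eq_bigr => x _; rewrite ffunE. Qed.

Lemma degN D : deg (- D) = - deg D.
Proof. by rewrite /deg -sumrN; apply: eq_bigr => x _; rewrite ffunE. Qed.

Lemma degB D E : deg (D - E) = deg D - deg E.
Proof. by rewrite degD degN. Qed.

Lemma degMn D n : deg (D *+ n) = deg D *+ n.
Proof. by rewrite /deg -sumrMnl; apply: eq_bigr => x _; rewrite ffunMnE. Qed.

Lemma degMz D (z : int) : deg (D *~ z) = deg D *~ z.
Proof. by rewrite /deg mulrz_suml; apply: eq_bigr => x _; rewrite ffunMzE. Qed.

Lemma deg_point v : deg (point v) = 1.
Proof.
rewrite /deg (bigD1 v) //= ffunE eqxx big1 // => x ne_x.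
by rewrite ffunE (negPf ne_x).
Qed.

Lemma deg_laplacian f : deg (laplacian f) = 0.
Proof.
rewrite /deg; under eq_bigr => x _ do rewrite ffunE.
under eq_bigr => x _ do under eq_bigr => y _ do rewrite mulrBr.
under eq_bigr => x _ do rewrite sumrB.
rewrite sumrB exchange_big /= -sumrB big1 // => x _.
by rewrite -sumrB big1 // => y _; rewrite mult_sym subrr.
Qed.

Lemma lin_equiv_deg D E : lin_equiv D E -> deg E = deg D.
Proof. by case/lin_equivP => f ->; rewrite degD deg_laplacian addr0. Qed.

Lemma effectiveD E F : effective E -> effective F -> effective (E + F).
Proof. by move=> hE hF x; rewrite ffunE addr_ge0. Qed.

Lemma effectiveMpoint v n : effective (point v *+ n).
Proof. by move=> x; rewrite ffunMnE ffunE mulrn_wge0. Qed.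

Lemma equiv_effective_equiv D E :
  lin_equiv D E -> equiv_effective D -> equiv_effective E.
Proof.
move=> eqDE [F F_ge0 eqDF]; exists F => //.
exact: lin_equiv_trans (lin_equiv_sym eqDE) eqDF.
Qed.

Lemma equiv_effectiveD D E :
  equiv_effective D -> effective E -> equiv_effective (D + E).
Proof.
move=> [F F_ge0 eqDF] E_ge0; exists (F + E); first exact: effectiveD.
exact: lin_equivD2r.
Qed.

Lemma rank_test_equiv D E r : lin_equiv D E -> rank_test D r -> rank_test E r.
Proof.
move=> eqDE testD F F_ge0 degF.
by apply: equiv_effective_equiv (testD F F_ge0 degF); apply: lin_equivD2r.
Qed.

Lemma rank_testB D r v s : rank_test D (r + s)%N -> rank_test (D - point v *+ s) r.
Proof.
move=> testD E E_ge0 degE; rewrite -addrA -opprD; apply: testD.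
  by apply: effectiveD => //; apply: effectiveMpoint.
by rewrite degD degE degMn deg_point; lia.
Qed.

Lemma rank_testW D r s : (r <= s)%N -> rank_test D s -> rank_test D r.
Proof.
move=> le_rs testD; have [v _] : exists v : G, true.
  by have /card_gt0P[v _] := vertex_nonempty G; exists v.
rewrite -(subrK (point v *+ (s - r)) D) => E E_ge0 degE.
rewrite addrAC; apply: equiv_effectiveD; last exact: effectiveMpoint.
by apply: (@rank_testB _ r) => //; rewrite subnKC.
Qed.

(** Compare with a putative effective divisor, reached from [D] by the script
    [f]: the earliest vertex among those where [f] is maximal has lost a chip
    along each edge to an earlier vertex, and gained none. *)
Lemma not_equiv_effective D (rk : G -> nat) :
  (forall x, D x < (\sum_(y | (rk y < rk x)%N) mult x y)%N%:Z) ->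
  ~ equiv_effective D.
Proof.
move=> ltD [E E_ge0 /lin_equivP[f defE]].
have /card_gt0P[v0 _] := vertex_nonempty G.
case: (@arg_maxP _ int G v0 predT f isT) => v _ max_v.
case: (@arg_minnP _ v (fun x => f x == f v) rk (eqxx _)) => x /eqP fx min_x.
have: E x < 0; last by rewrite ltNge E_ge0.
rewrite defE !ffunE -ltrBrDr sub0r; apply: lt_le_trans (ltD x) _.
rewrite raddf_sum /= -sumrN [leRHS](bigID (fun y => (rk y < rk x)%N)) /=.
rewrite -[leLHS]addr0 lerD ?sumr_ge0 //.
  apply: ler_sum => y lt_yx; have: f y != f x.
    by rewrite fx; apply: contraTneq lt_yx => fy; rewrite -leqNgt min_x ?fy.
  have := max_v y isT; rewrite -fx /= => le_f ne_f.
  have: f y - f x <= - 1 by lia.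
  by move=> /(ler_wpM2l (le0z_nat (mult x y))); lia.
move=> y _; have := max_v y isT; rewrite -fx /= => le_f.
by rewrite -mulrN mulr_ge0 //; lia.
Qed.

End Multigraph.

Lemma gonality_uniq (G : multigraph) r (d d' : int) :
  is_gonality G r d -> is_gonality G r d' -> d = d'.
Proof.
move=> [[D rkD <-] minD] [[D' rkD' <-] minD'].
by apply/le_anti; rewrite minD // minD'.
Qed.

(** * Triangular numbers and lists of integers *)

Definition pospart (z : int) : int := Num.max z 0.

Lemma bin2D a b : ('C(a + b, 2) = 'C(a, 2) + 'C(b, 2) + a * b)%N.
Proof.
elim: a => [|a IHa]; first by rewrite add0n bin0n addn0.
by rewrite addSn !binS !bin1 IHa; lia.
Qed.

Lemma binS2 n : 'C(n.+1, 2) = ('C(n, 2) + n)%N.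
Proof. by rewrite binS bin1. Qed.

Lemma bin2_double n : (2 * 'C(n, 2) = n * n.-1)%N.
Proof. by rewrite -mul_bin_diag bin1. Qed.

Lemma triangle_half l : (l * (l + 3))./2 = ('C(l.+2, 2) - 1)%N.
Proof. by have := bin2_double l.+2; lia. Qed.

Lemma leq_bin2 a b : (a <= b)%N -> ('C(a, 2) <= 'C(b, 2))%N.
Proof. by move=> /subnK <-; rewrite bin2D addnAC leq_addl. Qed.

(** Sorting values in increasing order and subtracting consecutive positions
    gives a list that drops by at most one at each step. *)
Definition slow : rel int := fun x y => x - 1 <= y.

Lemma slow_head_le x d (M : int) :
  0 <= M -> last x d <= M + 1 -> path slow x d ->
  x <= (count (> 0%R) (x :: d))%:Z + M.
Proof.
move=> M_ge0; elim: d x => [|y d IHd] x /=; first by lia.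
by move=> le_last /andP[xy yd]; have /= := IHd y le_last yd; move: xy; rewrite /slow; lia.
Qed.

(** Reading such a list from its last entry, each new positive entry exceeds
    the largest one seen so far by at most one. *)
Lemma sum_pospart_le d (M : int) :
  0 <= M -> last 0 d <= M + 1 -> sorted slow d ->
  \sum_(x <- d) pospart x
    <= (count (> 0%R) d)%:Z * M + 'C((count (> 0%R) d).+1, 2)%:Z.
Proof.
move=> M_ge0; elim: d => [|x d IHd] /=; first by rewrite big_nil mul0r.
move=> le_last xd; rewrite big_cons.
have {}IHd : \sum_(x <- d) pospart x
    <= (count (> 0%R) d)%:Z * M + 'C((count (> 0%R) d).+1, 2)%:Z.
  case: d xd le_last IHd => [_ _ _|y d /= /andP[_ yd] le_last IHd].
    by rewrite big_nil mul0r.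
  exact: IHd.
have := slow_head_le M_ge0 le_last xd; rewrite /=.
move: IHd; set c := count _ d; set S := \sum_(_ <- d) _.
have := binS2 c.+1.
by rewrite /pospart; case: (ltP 0 x) => x_gt0 /=; rewrite ?add0n ?add1n; nia.
Qed.

(** Reversing a slow list and negating its entries gives a slow list. *)
Lemma sum_negpart_le d (M : int) :
  0 <= M -> - head 0 d <= M + 1 -> sorted slow d ->
  \sum_(y <- d) pospart (- y)
    <= (count (< 0%R) d)%:Z * M + 'C((count (< 0%R) d).+1, 2)%:Z.
Proof.
move=> M_ge0 le_d srt_d; set e := rev [seq - y | y <- d].
have srt_e : sorted slow e.
  rewrite rev_sorted sorted_map; apply: sub_sorted srt_d => y z.
  by rewrite /slow /=; lia.
have last_e : last 0 e = - head 0 d.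
  by rewrite /e; case: (d) => [|x d'] /=; rewrite ?oppr0 // rev_cons last_rcons.
have := sum_pospart_le M_ge0 _ srt_e; rewrite last_e => /(_ le_d).
rewrite /e (perm_big _ (permEl (perm_rev _))) big_map count_rev count_map.
by rewrite (eq_count (a2 := (< 0%R))) // => y /=; rewrite oppr_gt0.
Qed.

Lemma count_pos_neg (d : seq int) : (count (> 0%R) d + count (< 0%R) d <= size d)%N.
Proof. by elim: d => //= x d IHd; lia. Qed.

(** ** Rotations *)

Section Rotations.

(* [R d] says that the list of excesses [d] can be reached on a layer above [T]
   vertices; the hypothesis is the effect of one rotation. *)
Variables (T : nat) (R : seq int -> Prop).
Hypothesis step : forall x d, R (x :: d) -> R (rcons d (x + T.+1%:Z)).

(** The bi-infinite sequence extending [d] by [d_(j+q) = d_j + T + 1], where [q]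
    is the length of [d], still drops by at most one; the rotations of [d] are
    its windows of length [q]. *)
Definition quasicyclic (d : seq int) :=
  sorted slow (rcons d (head 0 d + T.+1%:Z)).

Lemma quasicyclic_step x d :
  quasicyclic (x :: d) -> quasicyclic (rcons d (x + T.+1%:Z)).
Proof.
rewrite /quasicyclic /=; case: d => [|y d] /=; first by rewrite /slow; lia.
by rewrite !rcons_path last_rcons /slow => /andP[xy] /andP[-> ->] /=; lia.
Qed.

Lemma quasicyclic_sorted d : quasicyclic d -> sorted slow d.
Proof. by case: d => //= x d; rewrite /quasicyclic /= rcons_path => /andP[]. Qed.

(** Rotate until the head reaches [-T].  An entry is moved only while it is
    smaller than [-T], so it is at most zero after the move. *)
Lemma rotate_to_reduced d :
  (0 < size d)%N -> R d -> quasicyclic d -> all (<= 0) d ->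
  exists e, [/\ R e, quasicyclic e, all (<= 0) e, size e = size d
              & - T%:Z <= head 0 e].
Proof.
have [n] := ubnP (\sum_(x <- d) `|x|)%N.
elim: n d => // n IHn [//|x d] lt_n _ Rd cyc_d /=/andP[x_le0 d_le0].
have [ge_x|lt_x] := leP (- T%:Z) x.
  by exists (x :: d); rewrite /= x_le0 d_le0.
have [|||||e [Re ce ae se he]] := IHn (rcons d (x + T.+1%:Z)).
- move: lt_n; rewrite -cats1 big_cat big_seq1 big_cons /=; lia.
- by rewrite size_rcons.
- exact: step.
- exact: quasicyclic_step.
- by rewrite all_rcons d_le0 andbT; rewrite /=; lia.
by exists e; split=> //; rewrite se size_rcons.
Qed.

(** Rotate until [l <= head + T + s] and at most [p] entries are negative, where
    [s] counts the positive entries.  While one of these conditions fails, a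
    rotation preserves [s <= l], and the upper bound on the last entry whenever
    at most [p] entries are negative.  With the bounds on the two ends, slowness
    makes the positive entries sum to at most [l + (l - 1) + ...] and the negative
    ones to at least [- (p + (p - 1) + ...)]. *)
Lemma rotate_to_balanced (l p : nat) d :
  (0 < T)%N -> (0 < size d)%N -> (l + p + 1 = T + size d)%N ->
  R d -> quasicyclic d -> all (<= 0) d ->
  exists e, [/\ R e, quasicyclic e, size e = size d,
     (count (> 0%R) e <= l)%N /\ (count (< 0%R) e <= p)%N
   & last 0 e + (count (> 0%R) e)%:Z <= l%:Z + 1 /\
     l%:Z <= head 0 e + T%:Z + (count (> 0%R) e)%:Z].
Proof.
move=> T_gt0 d_gt0 def_lp Rd cyc_d d_le0.
have pos_d : count (> 0%R) d = 0%N.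
  apply/eqP; rewrite -leqn0 leqNgt -has_count; apply/hasPn => x.
  by move/(allP d_le0) => /=; lia.
have le_pos : (count (> 0%R) d <= l)%N by rewrite pos_d.
have le_last : (count (< 0%R) d <= p)%N ->
    last 0 d + (count (> 0%R) d)%:Z <= l%:Z + 1.
  move=> _; rewrite pos_d; case: {+}d d_gt0 d_le0 => // x d' _ /allP/(_ (last x d')).
  by rewrite mem_last => /(_ isT) /=; lia.
(* Every rotation raises an entry that is still below [l + size d]. *)
have [n] := ubnP (\sum_(x <- d) `|pospart (l%:Z + (size d)%:Z - x)|)%N.
elim: n d d_gt0 def_lp Rd cyc_d {d_le0 pos_d} le_pos le_last => // n IHn.
case=> [//|x d] _ def_lp Rd cyc_d le_pos le_last lt_n.
have [/andP[le_neg ge_x]|] := boolP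
  ((count (< 0%R) (x :: d) <= p)%N
     && (l%:Z <= x + T%:Z + (count (> 0%R) (x :: d))%:Z)).
  by exists (x :: d); split=> //; split=> //; apply: le_last.
move=> not_done; have cnt := count_pos_neg (x :: d).
have slow_d := quasicyclic_sorted cyc_d.
(* The list drops by at most one at each step, so its head is at most the number
   of steps when some entry is negative. *)
have neg_head : (count (< 0%R) (x :: d) > p)%N -> x <= (size d)%:Z.
  have: forall y, path slow y d -> has (< 0%R) (y :: d) -> y <= (size d)%:Z.
    elim: {+}d => [|z e IHe] y /=; first by lia.
    by rewrite /slow => /andP[yz ze] /orP[|/(IHe z ze)]; lia.
  by move=> H gt_p; apply: H => //; rewrite has_count; lia.
set y : int := x + T.+1%:Z.
have cntP : count (> 0%R) (rcons d y) = (count (> 0%R) d + (y > 0)%R)%N.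
  by rewrite -cats1 count_cat /= addn0.
have cntN : count (< 0%R) (rcons d y) = (count (< 0%R) d + (y < 0)%R)%N.
  by rewrite -cats1 count_cat /= addn0.
have sz : size (rcons d y) = size (x :: d) by rewrite size_rcons.
case: (IHn (rcons d y)).
- by rewrite sz.
- by rewrite sz.
- exact: step.
- exact: quasicyclic_step.
- move: not_done le_pos cnt def_lp; rewrite cntP /= /y; lia.
- rewrite last_rcons cntP cntN; move: not_done le_pos cnt le_last neg_head def_lp.
  rewrite /= /y; lia.
- move: lt_n; rewrite sz -cats1 big_cat big_seq1 big_cons /= /pospart.
  move: not_done le_pos cnt neg_head def_lp; rewrite /= /y; lia.
by move=> e [Re ce se le1 le2]; exists e; split=> //; rewrite se sz.
Qed.

End Rotations.

(** ** Distinct integers *)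

Lemma bin2_le_sumn (s : seq nat) : uniq s -> ('C(size s, 2) <= sumn s)%N.
Proof.
have [n] := ubnP (size s); elim: n s => // n IHn s lt_n uniq_s.
case: (posnP (size s)) => [-> //|s_gt0].
have [x xs ge_x] : exists2 x, x \in s & ((size s).-1 <= x)%N.
  have [/allP lt_s|] := boolP (all (fun x => x < (size s).-1)%N s); last first.
    by rewrite -has_predC => /hasP[x xs /=]; rewrite -leqNgt; exists x.
  have: {subset s <= iota 0 (size s).-1} by move=> y /lt_s; rewrite mem_iota.
  by move/(uniq_leq_size uniq_s); rewrite size_iota leqNgt prednK ?leqnn.
have := IHn (rem x s); rewrite size_rem // rem_uniq // (perm_sumn (perm_to_rem xs)) /=.
case: (size s) s_gt0 lt_n ge_x => // m _ lt_n ge_x /= /(_ lt_n isT).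
by rewrite binS2; lia.
Qed.

Lemma bin2_le_pos (s : seq int) :
  uniq s -> 'C((count (> 0%R) s).+1, 2)%:Z <= \sum_(y <- s) pospart y.
Proof.
move=> uniq_s; set t := [seq `|y|%N | y <- 0 :: filter (> 0%R) s].
have uniq_t : uniq t.
  rewrite map_inj_in_uniq /= ?filter_uniq ?mem_filter ?ltxx //.
  move=> y z; rewrite !inE !mem_filter.
  by case/predU1P=> [->|/andP[y_gt0 _]] /predU1P[->|/andP[z_gt0 _]]; lia.
have := bin2_le_sumn uniq_t; rewrite size_map /= size_filter.
have -> : \sum_(y <- s) pospart y = (sumn t)%:Z.
  rewrite /t /=; elim: {uniq_s t uniq_t} s => [|y s IHs]; first by rewrite big_nil.
  by rewrite big_cons IHs /pospart /=; case: (ltP 0 y) => y0; rewrite /= PoszD; lia.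
by [].
Qed.

Lemma bin2_le_neg (s : seq int) :
  uniq s -> 'C(size s - count (> 0%R) s, 2)%:Z <= \sum_(y <- s) pospart (- y).
Proof.
move=> uniq_s; set t := [seq `|y|%N | y <- filter (<= 0%R) s].
have uniq_t : uniq t.
  rewrite map_inj_in_uniq ?filter_uniq //.
  by move=> y z; rewrite !mem_filter /= => /andP[y_le0 _] /andP[z_le0 _]; lia.
have := bin2_le_sumn uniq_t; rewrite size_map size_filter.
have -> : (size s - count (> 0%R) s)%N = count (<= 0%R) s.
  by rewrite -(count_predC (<= 0%R) s) (eq_count (a1 := predC _) (a2 := (> 0%R)))
    ?addnK // => y /=; rewrite ltNge.
have -> : \sum_(y <- s) pospart (- y) = (sumn t)%:Z.
  rewrite /t /=; elim: {uniq_s t uniq_t} s => [|y s IHs]; first by rewrite big_nil.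
  by rewrite big_cons IHs /pospart /=; case: (leP y 0) => y0; rewrite /= ?PoszD; lia.
by [].
Qed.

Lemma sum_pos_neg (s : seq int) :
  \sum_(y <- s) y = \sum_(y <- s) pospart y - \sum_(y <- s) pospart (- y).
Proof.
by rewrite -sumrB; apply: eq_bigr => y _; rewrite /pospart; lia.
Qed.

(** The positive parts of the [k + 1] consecutive integers [z + 1], [z], ...,
    [z + 1 - k]; the binomial coefficient [C(z + 2, 2)] while [-1 <= z <= k]. *)
Definition staircase (k : nat) (z : int) : int :=
  \sum_(j < k.+1) pospart (z + 1 - j%:Z).

Lemma sum_natz n : \sum_(j < n) j%:Z = 'C(n, 2)%:Z.
Proof. by rewrite -bin2_sum raddf_sum /= big_mkord. Qed.

Lemma staircaseS k z :
  staircase k.+1 z = staircase k z + pospart (z + 1 - k.+1%:Z).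
Proof. by rewrite /staircase big_ord_recr. Qed.

Lemma staircase_large k (z : int) :
  k%:Z <= z -> staircase k z = k.+1%:Z * (z + 1) - 'C(k.+1, 2)%:Z.
Proof.
elim: k => [|k IHk] le_kz.
  by rewrite /staircase big_ord1 /pospart bin_small //=; lia.
have bin_k := binS2 k.+1; rewrite staircaseS IHk; last by lia.
by rewrite /pospart bin_k; nia.
Qed.

Lemma staircase_small k n :
  (n <= k.+1)%N -> staircase k (n%:Z - 1) = 'C(n.+1, 2)%:Z.
Proof.
elim: k => [|k IHk].
  by rewrite /staircase big_ord1 /pospart; case: n => [|[|n]] //= _;
     rewrite ?bin_small //= ?binn; lia.
rewrite leq_eqVlt ltnS => /predU1P[->|le_n]; last first.
  by rewrite staircaseS IHk // /pospart; lia.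
rewrite staircase_large; last by lia.
by have := binS2 k.+2; have := bin2_double k.+2; nia.
Qed.

(** If [c] of the distinct integers are positive, the positive ones sum to at
    least [C(c + 1, 2)] and the others to at most [- C(k + 1 - c, 2)].  With
    the sum fixed, the first bound suffices when [c] is at least the number of
    positive steps of the staircase, and the second one otherwise. *)
Lemma staircase_min k (z : int) (s : seq int) :
  uniq s -> size s = k.+1 ->
  \sum_(y <- s) y = k.+1%:Z * (z + 1) - 'C(k.+1, 2)%:Z ->
  staircase k z <= \sum_(y <- s) pospart y.
Proof.
move=> uniq_s size_s sum_s; have := bin2_le_neg uniq_s; have := bin2_le_pos uniq_s.
rewrite size_s; set c := count _ _; move: sum_s; rewrite sum_pos_neg.
set P := \sum_(y <- s) pospart y; set Q := \sum_(y <- s) pospart (- y).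
move=> sum_s le_P le_Q; have [le_kz|lt_zk] := leP (k%:Z) z.
  by rewrite staircase_large //; lia.
have [z_lt0|z_ge0] := ltP (z + 1) 0.
  rewrite /staircase big1; first by lia.
  by move=> j _; rewrite /pospart; lia.
have [n def_z] : exists n : nat, z = n%:Z - 1 by exists (absz (z + 1)); lia.
rewrite {}def_z in sum_s lt_zk *; rewrite staircase_small; last by lia.
have [le_nc|lt_cn] := leqP n c.
  by have := @leq_bin2 n.+1 c.+1 le_nc; lia.
have le_bin : ('C(k.+1 - n, 2) <= 'C(k.+1 - c, 2))%N by apply: leq_bin2; lia.
have := bin2D n (k.+1 - n); have := binS2 n; have := bin2_double n.+1.
rewrite subnKC; last by lia.
have [t def_t] : exists t, (k.+1 - n)%N = t by exists (k.+1 - n)%N.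
have def_k : k.+1 = (n + t)%N by lia.
by move: sum_s le_bin le_Q; rewrite def_t def_k /=; lia.
Qed.

(** The numbers [z + 1 - j] for [j <= N] and [z + M * a j - (N + j)] for [j < q]
    represent each residue modulo [M = N + q + 1] once; in particular they are
    distinct.  Their sum is that of the consecutive integers going down from
    [z + \sum_j a j + 1]. *)
Lemma staircase_layer N q (z : int) (a : 'I_q -> int) :
  staircase (N + q) (z + \sum_j a j)
    <= staircase N z
       + \sum_(j < q) pospart (z + (N + q).+1%:Z * a j - (N + j)%:Z).
Proof.
have [M def_M] : exists M : int, M = (N + q).+1%:Z by eexists.
rewrite -def_M; pose s := [seq z + 1 - j%:Z | j : 'I_N.+1 <- enum 'I_N.+1]
  ++ [seq z + M * a j - (N + j)%:Z | j : 'I_q <- enum 'I_q].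
have small (x y : int) : M * x = y -> - M < y -> y < M -> x = 0.
  by clear -def_M; nia.
have inj1 : injective (fun j : 'I_N.+1 => z + 1 - j%:Z).
  by move=> i j /= eq_ij; apply/val_inj => /=; lia.
have inj2 : injective (fun j : 'I_q => z + M * a j - (N + j)%:Z).
  move=> i j /= eq_ij; have lt_i := ltn_ord i; have lt_j := ltn_ord j.
  have eq_a : a i - a j = 0 by apply: (small _ (i%:Z - j%:Z)); rewrite ?mulrBr; lia.
  by apply/val_inj => /=; move: eq_ij; rewrite (subr0_eq eq_a); lia.
have uniq_s : uniq s.
  rewrite cat_uniq (map_inj_uniq inj1) (map_inj_uniq inj2) !enum_uniq andbT /=.
  apply/hasPn => y /mapP[j _ ->]; apply/mapP => -[i _ eq_ij].
  have lt_i := ltn_ord i; have lt_j := ltn_ord j.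
  have a0 : a j = 0 by apply: (small _ ((N + j)%N%:Z + 1 - i%:Z)); lia.
  by move: eq_ij; rewrite a0 mulr0; lia.
have sum_s (F : int -> int) : \sum_(y <- s) F y =
    \sum_(j < N.+1) F (z + 1 - j%:Z) + \sum_(j < q) F (z + M * a j - (N + j)%:Z).
  by rewrite big_cat; congr (_ + _); rewrite big_map big_enum.
have := @staircase_min (N + q) (z + \sum_j a j) s uniq_s.
rewrite !sum_s; apply.
  by rewrite size_cat size_map [X in (_ + X)%N]size_map !size_enum_ord addSn.
have sum_N : \sum_(j < q) (N + j)%N%:Z = N%:Z * q%:Z + 'C(q, 2)%:Z.
  under eq_bigr => j _ do rewrite PoszD.
  by rewrite big_split /= sum_natz sumr_const card_ord -mulr_natr natz.
rewrite !sumrB !big_split /= -!big_distrr /= !sumr_const !card_ord !sum_natz sum_N.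
have natM (x : int) n : x *+ n = x * n%:Z by rewrite -mulr_natr natz.
rewrite !natM.
have := bin2D N.+1 q; rewrite addSn; set A := \sum_j a j => bin_k.
by rewrite bin_k def_M; set B := 'C(q, 2); rewrite (binS2 N); lia.
Qed.

(** The excesses of vertices of values [w] at places [T], [T + 1], ... *)
Fixpoint unplace (T : nat) (w : seq int) : seq int :=
  if w is x :: w' then (x - T%:Z) :: unplace T.+1 w' else [::].

Lemma size_unplace T w : size (unplace T w) = size w.
Proof. by elim: w T => //= x w IHw T; rewrite IHw. Qed.

Lemma nth_unplace T w j : (j < size w)%N -> nth 0 (unplace T w) j = nth 0 w j - (T + j)%N%:Z.
Proof.
elim: w T j => [|x w IHw] T [|j] //= lt_j; first by rewrite addn0.
by rewrite IHw // addSnnS.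
Qed.

Lemma unplace_cat T w1 w2 :
  unplace T (w1 ++ w2) = unplace T w1 ++ unplace (T + size w1)%N w2.
Proof.
by elim: w1 T => [|x w1 IHw] T /=; rewrite ?addn0 // IHw addSnnS.
Qed.

Lemma sorted_unplace T w : sorted slow (unplace T w) = sorted <=%R w.
Proof.
case: w => //= x w; elim: w x T => //= y w IHw x T; rewrite IHw; congr (_ && _).
by rewrite /slow; lia.
Qed.

Lemma sorted_zeros (w : seq int) : sorted <=%R w -> all (>= 0) w ->
  exists n (w' : seq int), w = nseq n 0 ++ w' /\ all (>= 1) w'.
Proof.
elim: w => [|x w IHw] /=; first by exists 0%N, [::].
move=> xw /andP[x_ge0 w_ge0]; have [x_gt0|x_le0] := ltP 0 x.
  exists 0%N, (x :: w); split=> //=; apply/andP; split; first by lia.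
  by apply: sub_all (order_path_min le_trans xw) => y /= le_xy; apply: le_trans le_xy.
have [n [w' [-> w'P]]] := IHw (path_sorted xw) w_ge0.
by exists n.+1, w'; split=> //=; congr (_ :: _); apply: le_anti; rewrite x_le0.
Qed.

Lemma sum_ge_size (w : seq int) : all (>= 1) w -> (size w)%:Z <= \sum_(x <- w) x.
Proof.
elim: w => [|y w IHw] /=; first by rewrite big_nil.
by case/andP=> y_ge1 /IHw; rewrite big_cons -addn1 PoszD addrC => /(lerD y_ge1).
Qed.

Lemma all_eq1 (w : seq int) :
  all (>= 1) w -> \sum_(x <- w) x <= (size w)%:Z -> all (pred1 1) w.
Proof.
elim: w => //= x w IHw /andP[x_ge1 w_ge1]; rewrite big_cons.
move: (sum_ge_size w_ge1) (IHw w_ge1); move: (\sum_(_ <- w) _) => S le_S {}IHw le_xS.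
by rewrite IHw ?andbT; [apply/eqP; lia|lia].
Qed.

Lemma sum_all1 (w : seq int) : all (pred1 1) w -> \sum_(x <- w) x = (size w)%:Z.
Proof.
elim: w => [|x w IHw] /=; first by rewrite big_nil.
by case/andP=> /eqP-> /IHw; rewrite big_cons => ->.
Qed.

Lemma sum_pospart0 (d : seq int) : all (<= 0) d -> \sum_(y <- d) pospart y = 0.
Proof.
move=> /allP d_le0; rewrite big_seq big1 // => y /d_le0 /=; rewrite /pospart; lia.
Qed.

Lemma sum_shift (d : seq int) c :
  \sum_(y <- [seq y + c | y <- d]) y = \sum_(y <- d) y + (size d)%:Z * c.
Proof.
elim: d => [|y d IHd] /=; first by rewrite !big_nil mul0r.
by rewrite !big_cons IHd -addn1 PoszD; ring.
Qed.

(** The zeros of a layer, except a first one at place [T], stay at excess at most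
    zero when they are rotated. *)
Lemma unplace_zeros_le0 T T' n : (T < T')%N ->
  all (<= 0) [seq y + T.+1%:Z | y <- unplace T' (nseq n 0)].
Proof.
elim: n T' => //= n IHn T' lt_T; rewrite IHn ?andbT; last exact: ltnW.
by rewrite sub0r; lia.
Qed.

(** * Layered graphs *)

Definition card_below (G : multigraph) (lay : G -> nat) (i : nat) : nat :=
  #|[pred x : G | (lay x < i)%N]|.

(** The layer structure of a quasi-banana graph.  As layer 0 is a single vertex,
    the number of edges from the hub of layer [i] to a vertex of layer [i + 1],
    which is two plus the sizes of the layers 1 to [i], is one plus the number of
    vertices in the layers 0 to [i]. *)
Record layering (G : multigraph) := Layering {
  height : nat;
  lay : G -> nat;
  hub : nat -> G;
  lay_le : forall x, (lay x <= height)%N;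
  lay_hub : forall i, (i <= height)%N -> lay (hub i) = i;
  lay_root : forall x, lay x = 0%N -> x = hub 0;
  mult_lay : forall x y,
    let up x y := ((x == hub (lay x)) && (lay y == (lay x).+1)
                     * (card_below lay (lay x).+1).+1)%N in
    mult x y = if lay x == lay y then (x != y : nat) else (up x y + up y x)%N }.

Section Layered.

Variables (G : multigraph) (Q : layering G).

Local Notation lay := (lay Q).
Local Notation hub := (hub Q).
Local Notation height := (height Q).
Local Notation below := (card_below lay).
Local Notation root := (hub 0).

Implicit Types (D W : divisor G) (f g a : G -> int) (o : nat -> seq G).

Definition layer_seq (i : nat) : seq G := enum [pred x | lay x == i].

Lemma mem_layer i x : (x \in layer_seq i) = (lay x == i).
Proof. by rewrite mem_enum. Qed.

Lemma big_layer i (F : G -> int) :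
  \sum_(x <- layer_seq i) F x = \sum_(x | lay x == i) F x.
Proof. by rewrite big_enum. Qed.

Lemma below0 : below 0 = 0%N.
Proof. by rewrite /card_below eq_card0. Qed.

Lemma below_sumS (R : nmodType) (F : G -> R) i :
  \sum_(x | (lay x < i.+1)%N) F x
    = \sum_(x | (lay x < i)%N) F x + \sum_(x | lay x == i) F x.
Proof.
rewrite (bigID (fun x => lay x == i)) /= addrC; congr (_ + _); apply: eq_bigl => x.
  by rewrite ltnS ltn_neqAle andbC.
by rewrite ltnS; case: eqP => [->|_]; rewrite ?leqnn ?andbF.
Qed.

Lemma belowS i : below i.+1 = (below i + size (layer_seq i))%N.
Proof. by rewrite /card_below -cardE -!sum1_card; apply: (@below_sumS nat). Qed.

Lemma lay_hub0 : lay root = 0%N.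
Proof. exact: lay_hub. Qed.

Lemma lay_eq0 x : (lay x == 0%N) = (x == root).
Proof. by apply/eqP/eqP => [/lay_root|->] //; apply: lay_hub0. Qed.

Lemma below1 : below 1 = 1%N.
Proof.
rewrite belowS below0 add0n -cardE -(card1 root); apply: eq_card => x.
by rewrite !inE lay_eq0.
Qed.

Lemma leq_below i j : (i <= j)%N -> (below i <= below j)%N.
Proof.
move=> le_ij; apply/subset_leq_card/subsetP => x; rewrite !inE => lt_xi.
exact: leq_trans le_ij.
Qed.

Lemma below_gt0 i : (0 < i)%N -> (0 < below i)%N.
Proof. by move=> /leq_below; rewrite below1. Qed.

Lemma below_height : below height.+1 = #|G|.
Proof. by apply: eq_card => x; rewrite !inE ltnS lay_le. Qed.

Lemma layer_hub i : (i <= height)%N -> hub i \in layer_seq i.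
Proof. by move=> le_i; rewrite mem_layer lay_hub. Qed.

Lemma layer_gt0 i : (i <= height)%N -> (0 < size (layer_seq i))%N.
Proof. by move=> /layer_hub; case: (layer_seq i). Qed.

(** ** Linear equivalence, one layer at a time *)

(** The number of chips that a vertex of layer [i] gives away when it is fired
    together with everything above it: one to each other vertex of the layer and
    [below i + 1] to the hub underneath, the vertex itself counting as one more
    recipient. *)
Definition modulus (i : nat) : int := (below i.+1).+1%:Z.

Definition layer_sum g i : int := \sum_(x | lay x == i) g x.

(** The Laplacian in the coordinates [g x = f x - f h], where [h] is the hub of
    the layer below [x]. *)
Definition script_div g : divisor G :=
  [ffun x => layer_sum g (lay x) - modulus (lay x) * g x
     + (x == hub (lay x))%:Z * (modulus (lay x) * layer_sum g (lay x).+1)].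

Lemma hub_predP x y : (0 < lay x)%N ->
  (y == hub (lay y)) && (lay x == (lay y).+1) = (y == hub (lay x).-1).
Proof.
move=> lx_gt0; apply/andP/eqP => [[/eqP def_y /eqP ->] //|->].
by rewrite lay_hub ?eqxx ?prednK //; have := lay_le Q x; lia.
Qed.

(** The edges at [x] lead to its own layer, to the layer above if [x] is a hub,
    and to the hub below. *)
Lemma laplacian_layers f :
  laplacian f = script_div (fun x => f x - f (hub (lay x).-1)).
Proof.
pose g x := f x - f (hub (lay x).-1).
apply/ffunP => x; rewrite !ffunE -/g -/(g x).
have split_mult y : (mult x y)%:Z * (f y - f x) =
    (if lay y == lay x then g y - g x else 0)
    + (if lay y == (lay x).+1
       then (x == hub (lay x))%:Z * (modulus (lay x) * g y) else 0)
    + (if y == hub (lay x).-1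
       then - ((0 < lay x)%N%:Z * ((below (lay x)).+1%:Z * g x)) else 0).
  rewrite (mult_lay Q) (eq_sym (lay y) (lay x)).
  have [eq_xy|ne_xy] := eqVneq (lay x) (lay y).
    rewrite (_ : lay y == (lay x).+1 = false) ?eq_xy; last by rewrite -eq_xy; lia.
    rewrite addr0 (_ : (if _ then _ else _) = 0) ?addr0.
      by have [->|_] := eqVneq x y; rewrite /g ?subrr ?mulr0 // mul1r -eq_xy; ring.
    case: eqP => // def_y; case: posnP => [_|lx_gt0]; first by rewrite mul0r oppr0.
    have := @lay_hub _ Q (lay y).-1; rewrite -def_y.
    by have := lay_le Q y; lia.
  rewrite add0r PoszD mulrDl; congr (_ + _).
    have [ly|_] := eqVneq (lay y) (lay x).+1; last by rewrite andbF mul0n mul0r.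
    rewrite andbT; have [def_x|_] := eqVneq x (hub (lay x)); last by rewrite mul0n !mul0r.
    by rewrite mul1n mul1r /g ly /= -def_x.
  case: (posnP (lay x)) => [lx0|lx_gt0].
    by rewrite lx0 andbF mul0n !mul0r oppr0 if_same.
  rewrite hub_predP //; case: eqP => [def_y|_]; last by rewrite mul0n mul0r.
  have ly : lay y = (lay x).-1 by rewrite def_y lay_hub //; have := lay_le Q x; lia.
  by rewrite mul1n mul1r ly prednK // -mulrN /g def_y opprB.
rewrite (eq_bigr _ (fun y _ => split_mult y)) !big_split /= -!big_mkcond /=.
rewrite big_pred1_eq sumrB sumr_const -!big_distrr /=.
have -> : #|[pred y | lay y == lay x]| = size (layer_seq (lay x)) by rewrite cardE.
rewrite /modulus -!/(layer_sum _ _) belowS; case: (posnP (lay x)) => [lx|_].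
  have -> : g x = 0 by rewrite /g lx /= -(lay_root lx) subrr.
  by rewrite !mulr0 !mul0rn oppr0 !addr0.
by rewrite mul1r -mulr_natl natz; move: (_ * (_ * layer_sum _ _)) => S; lia.
Qed.

(** Any [g] vanishing at the root comes from a script: sum it along the hubs. *)
Lemma lin_equiv_scriptP D E :
  lin_equiv D E <-> exists2 g, g root = 0 & E = D + script_div g.
Proof.
split=> [/lin_equivP[f ->]|[g g0 ->]].
  by rewrite laplacian_layers; eexists; last reflexivity; rewrite /= lay_hub0 subrr.
pose f x := g x + \sum_(j < lay x) g (hub j).
apply/lin_equivP; exists f; rewrite laplacian_layers; congr (_ + _).
suff eq_g x : f x - f (hub (lay x).-1) = g x.
  by apply/ffunP => x; rewrite !ffunE /layer_sum eq_g;
     congr (_ - _ + _ * (_ * _)); apply: eq_bigr.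
rewrite /f lay_hub; last by have := lay_le Q x; lia.
case lx: (lay x) => [|j] /=; last by rewrite big_ord_recr /=; ring.
by rewrite big_ord0 (lay_root lx) g0; ring.
Qed.

(** ** Orderings and the rank *)

(** Only the order within each layer is recorded; [place] puts the layers one
    after another, starting with the root. *)
Definition ordering o := forall i, perm_eq (o i) (layer_seq i).

Definition place o x : nat := (below (lay x) + index x (o (lay x)))%N.

(** [nu o x] is the number of edges from [x] to earlier vertices, minus one. *)
Definition nu o x : int := (place o x)%:Z - (lay x == 0%N)%:Z.

Definition cost o W x : int := pospart (W x - nu o x).

Lemma cost_ge0 o W x : 0 <= cost o W x.
Proof. by rewrite /cost /pospart; lia. Qed.

Lemma mem_ordering o i x : ordering o -> (x \in o i) = (lay x == i).
Proof. by move=> oP; rewrite (perm_mem (oP i)) mem_layer. Qed.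

Lemma uniq_ordering o i : ordering o -> uniq (o i).
Proof. by move=> oP; rewrite (perm_uniq (oP i)) enum_uniq. Qed.

Lemma big_ordering o i (F : G -> int) :
  ordering o -> \sum_(x | lay x == i) F x = \sum_(x <- o i) F x.
Proof. by move=> oP; rewrite (perm_big _ (oP i)) big_layer. Qed.

Lemma place_lt o x y : ordering o -> (lay y < lay x)%N -> (place o y < place o x)%N.
Proof.
move=> oP lt_yx; apply: (leq_trans _ (leq_addr _ _)).
apply: leq_trans (leq_below lt_yx); rewrite /place belowS ltn_add2l.
by rewrite -(perm_size (oP _)) index_mem mem_ordering.
Qed.

Lemma card_earlier o x : ordering o ->
  #|[pred y | (lay y == lay x) && (place o y < place o x)%N]| = index x (o (lay x)).
Proof.
move=> oP; set s := o (lay x); have uniq_s : uniq s by apply: uniq_ordering.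
have size_t : size (take (index x s) s) = index x s by rewrite size_takel // index_size.
rewrite -[RHS]size_t -(card_uniqP (take_uniq _ uniq_s)); apply: eq_card => y.
rewrite inE; have [eq_l|ne_l] /= := eqVneq (lay y) (lay x).
  by rewrite in_take ?mem_ordering ?eq_l // /place eq_l ltn_add2l.
by apply/esym/negP => /mem_take; rewrite mem_ordering // (negPf ne_l).
Qed.

Lemma nu_root o : ordering o -> nu o root = -1.
Proof.
move=> oP; rewrite /nu /place lay_hub0 below0 /= add0n.
have := perm_size (oP 0%N); have := belowS 0; rewrite below0 below1 add0n => <-.
have := mem_ordering 0 root oP; rewrite lay_hub0 eqxx.
by case: (o 0%N) => [|y []] //=; rewrite inE eq_sym => ->.
Qed.

(** A vertex [x] has [below (lay x) + 1] edges to the hub below and one to each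
    earlier vertex of its layer: one more than its place. *)
Lemma not_effective_nu o W :
  ordering o -> (forall x, W x <= nu o x) -> ~ equiv_effective W.
Proof.
move=> oP leW; apply: (@not_equiv_effective _ _ (place o)) => x.
apply: le_lt_trans (leW x) _; have [lx0|lx_gt0] := posnP (lay x).
  by rewrite (lay_root lx0) nu_root.
rewrite /nu (gtn_eqF lx_gt0) subr0 ltz_nat.
have le_h : ((lay x).-1 <= height)%N by have := lay_le Q x; lia.
rewrite (bigD1 (hub (lay x).-1)) /=; last by apply: place_lt; rewrite ?lay_hub //; lia.
rewrite mult_sym (mult_lay Q) lay_hub // eqxx prednK // eqxx.
have -> : ((lay x).-1 == lay x) = false by lia.
suff le_idx : (index x (o (lay x))
    <= \sum_(y | (place o y < place o x)%N && (y != hub (lay x).-1)) mult x y)%N.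
  by rewrite -[X in (X < _)%N]/(below (lay x) + index x (o (lay x)))%N /=; lia.
rewrite -[leqLHS](card_earlier x oP) -sum1_card big_mkcond [leqRHS]big_mkcond.
apply: leq_sum => y _; rewrite inE.
have [eq_l|_] //= := eqVneq (lay y) (lay x); case: ifP => //= lt_yx.
have -> : y != hub (lay x).-1.
  by apply: contraPneq eq_l => ->; rewrite lay_hub //; lia.
rewrite (mult_lay Q) eq_l eqxx.
by have [eq_xy|] := eqVneq x y; first by rewrite eq_xy ltnn in lt_yx.
Qed.

(** Subtracting the effective divisor [cost o W] brings [W] below [nu o]. *)
Lemma rank_test_cost D W o r :
  rank_test D r -> lin_equiv D W -> ordering o -> r%:Z < \sum_x cost o W x.
Proof.
move=> testD eqDW oP; rewrite ltNge; apply/negP => le_r.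
have testW := rank_test_equiv eqDW testD.
have [s def_s] : exists s : nat, r%:Z = \sum_x cost o W x + s%:Z.
  by exists (absz (r%:Z - \sum_x cost o W x)%R); lia.
pose E : divisor G := [ffun x => cost o W x] + point root *+ s.
have E_ge x : cost o W x <= E x.
  by rewrite [E x]ffunE [X in X + _]ffunE lerDl; apply: effectiveMpoint.
have [||F F_ge0 eqF] := testW E.
- by move=> x; apply: le_trans (E_ge x); apply: cost_ge0.
- rewrite degD degMn deg_point def_s; congr (_ + _); last by rewrite natz.
  by apply: eq_bigr => x _; rewrite ffunE.
apply: (@not_effective_nu o (W - E) oP); last by exists F.
move=> x; have := E_ge x; rewrite [(W - E) x]ffunE [(- E) x]ffunE.
by rewrite /cost /pospart ge_max => /andP[le_E _]; rewrite lerBlDr -lerBlDl.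
Qed.

(** ** Moving chips on one layer *)

(** Minus the script [a] on layer [i], with everything above carried along: only
    layer [i] and the hub below it change. *)
Definition layer_move i a : divisor G :=
  [ffun x => if lay x == i then modulus i * a x - layer_sum a i else
             if x == hub i.-1 then - (modulus i.-1 * layer_sum a i) else 0].

Lemma lin_equiv_move D i a :
  (0 < i <= height)%N -> lin_equiv D (D + layer_move i a).
Proof.
move=> /andP[i_gt0 le_i]; apply/lin_equiv_scriptP.
pose g x := if lay x == i then - a x else 0; exists g.
  by rewrite /g lay_hub0; case: eqP => // i0; rewrite -i0 in i_gt0.
have sum_g j : layer_sum g j = if j == i then - layer_sum a i else 0.
  rewrite /layer_sum; case: eqP => [->|ne_ji]; rewrite -?sumrN; last first.
    by rewrite big1 // => x /eqP lx; rewrite /g lx; case: eqP.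
  by apply: eq_bigr => x lx; rewrite /g lx.
congr (_ + _); apply/ffunP => x; rewrite !ffunE !sum_g /g.
have [->|ne_lx] := eqVneq (lay x) i.
  by rewrite (_ : i.+1 == i = false) ?mulr0 ?addr0; [ring|lia].
have [def_x|ne_x] := eqVneq x (hub i.-1).
  have lx : lay x = i.-1 by rewrite def_x lay_hub //; lia.
  by rewrite lx -def_x eqxx prednK // eqxx mulr0 mul1r; ring.
rewrite mulr0 oppr0 addr0 add0r; have [lx|_] := eqVneq (lay x).+1 i; last by rewrite !mulr0.
by rewrite -lx /= in ne_x; rewrite (negPf ne_x) mul0r.
Qed.

Lemma sum_move i a : (0 < i <= height)%N ->
  \sum_(x | (lay x < i.+1)%N) layer_move i a x = 0.
Proof.
move=> /andP[i_gt0 le_i]; rewrite below_sumS (bigD1 (hub i.-1)) /=; last first.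
  by rewrite lay_hub; lia.
rewrite big1 ?addr0; last first.
  by move=> x /andP[lt_xi ne_x]; rewrite ffunE (negPf ne_x) (ltn_eqF lt_xi).
rewrite ffunE eqxx lay_hub; last by lia.
rewrite (_ : i.-1 == i = false); last by lia.
rewrite (eq_bigr (fun x => modulus i * a x - layer_sum a i)); last first.
  by move=> x lx; rewrite ffunE lx.
rewrite sumrB -big_distrr sumr_const /= -/(layer_sum a i).
have -> : #|[pred x | lay x == i]| = size (layer_seq i) by rewrite cardE.
by rewrite /modulus prednK // belowS -mulr_natl natz; nia.
Qed.

Definition excess i W (xs : seq G) : seq int :=
  [seq W x - (below i + index x xs)%N%:Z | x <- xs].

(** The lists of excesses that layer [i] can show when [D] is changed only on
    that layer and at the hub below it, the layer being listed in any order. *)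
Variant layer_state D i (d : seq int) : Prop :=
  LayerState W xs of lin_equiv D W & perm_eq xs (layer_seq i)
    & (forall x, lay x != i -> x != hub i.-1 -> W x = D x)
    & \sum_(x | (lay x < i.+1)%N) W x = \sum_(x | (lay x < i.+1)%N) D x
    & d = excess i W xs.

(** Move with [a] the indicator of the first vertex, then list this vertex last.
    The other vertices lose one chip and come one place earlier, so their
    excesses stay.  The first vertex gains [modulus i - 1] chips and its place
    grows by the size of the layer minus one. *)
Lemma layer_state_step D i x d : (0 < i <= height)%N ->
  layer_state D i (x :: d) -> layer_state D i (rcons d (x + (below i).+1%:Z)).
Proof.
move=> i_in [W [//|h xs] eqDW xsP sameW degW [def_x ->]].
pose a y : int := (y == h)%:Z.
have lh : lay h = i by apply/eqP; rewrite -mem_layer -(perm_mem xsP) mem_head.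
have sum_a : layer_sum a i = 1.
  rewrite /layer_sum (bigD1 h) ?lh //= /a eqxx big1 ?addr0 // => y.
  by case/andP=> _ /negPf->.
have /andP[h_xs uniq_xs] : uniq (h :: xs) by rewrite (perm_uniq xsP) enum_uniq.
apply: (@LayerState _ _ _ (W + layer_move i a) (rcons xs h)).
- exact: lin_equiv_trans eqDW (lin_equiv_move _ _ i_in).
- by rewrite perm_rcons.
- by move=> y ne_l ne_y; rewrite !ffunE (negPf ne_l) (negPf ne_y) addr0 sameW.
- rewrite -degW -[RHS]addr0 -[X in _ = _ + X](sum_move a i_in) -big_split.
  by apply: eq_bigr => y _; rewrite ffunE.
rewrite /excess map_rcons; congr (rcons _ _).
  apply/eq_in_map => y y_xs; have ne_yh : y != h by apply: contraNneq h_xs => <-.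
  have ly : lay y = i by apply/eqP; rewrite -mem_layer -(perm_mem xsP) inE y_xs orbT.
  rewrite !ffunE ly eqxx sum_a /a (negPf ne_yh) mulr0 /= eq_sym (negPf ne_yh).
  by rewrite -cats1 index_cat y_xs; lia.
rewrite !ffunE lh eqxx sum_a /a eqxx mulr1 def_x /= eqxx /modulus belowS.
by rewrite -(perm_size xsP) -cats1 index_cat (negPf h_xs) /= eqxx; lia.
Qed.

Lemma nth_excess i W xs j : uniq xs -> (j < size xs)%N ->
  nth 0 (excess i W xs) j = W (nth root xs j) - (below i + j)%N%:Z.
Proof. by move=> uniq_xs lt_j; rewrite (nth_map root) // index_uniq. Qed.

Lemma sum_excess i W xs : perm_eq xs (layer_seq i) ->
  \sum_(x | lay x == i) W x
    = \sum_(y <- excess i W xs) y + 'C(below i.+1, 2)%:Z - 'C(below i, 2)%:Z.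
Proof.
move=> xsP; have uniq_xs : uniq xs by rewrite (perm_uniq xsP) enum_uniq.
rewrite -big_layer -(perm_big _ xsP) /= big_map belowS -(perm_size xsP).
have sum_place : \sum_(x <- xs) (below i + index x xs)%N%:Z
    = (below i * size xs + 'C(size xs, 2))%N%:Z.
  rewrite (big_nth root) big_mkord [RHS]PoszD -sum_natz.
  under eq_bigr => j _ do rewrite index_uniq // PoszD.
  by rewrite big_split /= sumr_const card_ord -mulr_natr natz.
by rewrite sumrB sum_place bin2D; rewrite !PoszD; ring.
Qed.

Lemma layer_cost o i W : ordering o -> (0 < i)%N ->
  \sum_(x | lay x == i) cost o W x = \sum_(y <- excess i W (o i)) pospart y.
Proof.
move=> oP i_gt0; rewrite (big_ordering i _ oP) big_map; apply: eq_big_seq => x.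
rewrite (mem_ordering _ _ oP) => /eqP lx; rewrite /cost /nu /place lx.
by case: i i_gt0 {lx} => // i _; rewrite subr0.
Qed.

Lemma sorted_excess i W xs : uniq xs ->
  sorted (fun x y => W x <= W y) xs -> sorted slow (excess i W xs).
Proof.
move=> uniq_xs /(sortedP root) srt_xs; apply/(sortedP 0) => j.
rewrite size_map => lt_j; rewrite !nth_excess //; last exact: ltnW.
by have := srt_xs j lt_j; rewrite /slow; lia.
Qed.

(** Division with remainder by [modulus i] on the layer brings the values into an
    interval of length [modulus i], and a large common shift makes them
    negative.  Sorted, they give a quasicyclic list. *)
Lemma layer_state_start D i : (0 < i <= height)%N ->
  exists d, [/\ layer_state D i d, quasicyclic (below i) d, all (<= 0) d
              & size d = size (layer_seq i)].
Proof.
move=> i_in; have q_gt0 : (0 < size (layer_seq i))%N by apply: layer_gt0; case/andP: i_in.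
(* The values of [W] on the layer lie between [c] and [c + M - 1], and [A] is
   large enough to make [c + M <= 0]. *)
pose M := modulus i; pose S : int := \sum_(x | lay x == i) (D x %/ M)%Z.
pose A : int := (absz S)%:Z + M; pose a x : int := - (D x %/ M)%Z - A.
pose c : int := S - (below i).+1%:Z * A.
have M_gt0 : 0 < M by [].
have sum_a : layer_sum a i = - S - (size (layer_seq i))%:Z * A.
  rewrite /layer_sum sumrB sumrN sumr_const; congr (_ - _).
  by rewrite (_ : #|_| = size (layer_seq i)) ?cardE // -mulr_natl natz.
pose W := D + layer_move i a.
have def_M : M = (below i).+1%:Z + (size (layer_seq i))%:Z.
  by rewrite /M /modulus belowS; lia.
have W_layer x : lay x = i -> c <= W x <= c + M - 1.
  move=> lx; have -> : W x = (D x %% M)%Z + c.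
    rewrite !ffunE lx eqxx sum_a -/M {1}(divz_eq (D x) M) /a /c def_M; ring.
  have := modz_ge0 (D x) (lt0r_neq0 M_gt0); have := ltz_pmod (D x) M_gt0.
  by move: (_ %% _)%Z c => r c'; lia.
have c_le : c + M <= 0.
  have le_SA : S + M <= A by rewrite /A lerD2r; lia.
  have A_ge0 : 0 <= A by rewrite /A; lia.
  have le_A : A <= (below i).+1%:Z * A by rewrite ler_peMl //; lia.
  by rewrite /c; move: (_ * A) le_A le_SA => B le_A le_SA; lia.
pose xs := sort (fun x y => W x <= W y) (layer_seq i).
have xsP : perm_eq xs (layer_seq i) by rewrite perm_sort.
have uniq_xs : uniq xs by rewrite sort_uniq enum_uniq.
have W_xs j : (j < size xs)%N -> c <= W (nth root xs j) <= c + M - 1.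
  by move=> lt_j; apply: W_layer; apply/eqP; rewrite -mem_layer -(perm_mem xsP) mem_nth.
have size_xs : size xs = size (layer_seq i) by apply: perm_size.
exists (excess i W xs); split; last by rewrite size_map.
- apply: (@LayerState _ _ _ W xs) => //; first exact: lin_equiv_move.
    by move=> x ne_l ne_x; rewrite !ffunE (negPf ne_l) (negPf ne_x) addr0.
  rewrite -[RHS]addr0 -[X in _ = _ + X](sum_move a i_in) -big_split.
  by apply: eq_bigr => y _; rewrite ffunE.
- have srt : sorted slow (excess i W xs).
    by apply: sorted_excess => //; apply: sort_sorted => x y; apply: le_total.
  have last_d : last 0 (excess i W xs) - 1 <= c.
    rewrite -nth_last size_map nth_excess //; last by rewrite size_xs; lia.
    have := W_xs (size xs).-1; rewrite size_xs def_M; move: (W _) (c) => w c'; lia.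
  have head_d : c <= head 0 (excess i W xs) + (below i)%:Z.
    rewrite -nth0 nth_excess ?size_xs // addn0 subrK.
    by have := W_xs 0%N; rewrite size_xs => /(_ q_gt0) /andP[].
  rewrite /quasicyclic; case: excess (size_map _ xs : size (excess i W xs) = _) srt last_d head_d.
    by move=> /= sz; rewrite -size_xs -sz in q_gt0.
  by move=> y d _ /= yd last_d head_d; rewrite rcons_path yd /slow; lia.
apply/(all_nthP 0) => j; rewrite size_map => lt_j; rewrite nth_excess //=.
have /andP[_ le_W] := W_xs j lt_j; rewrite subr_le0; apply: le_trans le_W _.
by move: (c + M) c_le; lia.
Qed.

Lemma layer_state_reduced D i : (0 < i <= height)%N ->
  exists d, [/\ layer_state D i d, quasicyclic (below i) d, all (<= 0) d,
                size d = size (layer_seq i) & - (below i)%:Z <= head 0 d].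
Proof.
move=> i_in; have [d [Sd cyc_d d_le0 size_d]] := layer_state_start D i_in.
have step x e : layer_state D i (x :: e) -> layer_state D i (rcons e (x + (below i).+1%:Z)).
  exact: layer_state_step.
have [|e [Se cyc_e e_le0 size_e head_e]] := rotate_to_reduced step _ Sd cyc_d d_le0.
  by rewrite size_d layer_gt0; case/andP: i_in.
by exists e; split=> //; rewrite size_e.
Qed.

(** By [reduced_bounds], a divisor that is reduced on every layer above the root
    satisfies [0 <= W x <= nu o x] there. *)
Definition reduced_on W o i :=
  [/\ quasicyclic (below i) (excess i W (o i)), all (<= 0) (excess i W (o i))
    & - (below i)%:Z <= head 0 (excess i W (o i))].

Definition update o i xs : nat -> seq G := fun j => if j == i then xs else o j.

Lemma ordering_update o i xs :
  ordering o -> perm_eq xs (layer_seq i) -> ordering (update o i xs).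
Proof. by move=> oP xsP j; rewrite /update; case: eqP => [->|_]. Qed.

Lemma ordering_layer : ordering layer_seq.
Proof. by move=> i. Qed.

(** Reduce the layers from the top down: work on one layer disturbs only the
    layer below. *)
Lemma reduced_exists D : exists W o,
  [/\ lin_equiv D W, ordering o & forall i, (0 < i <= height)%N -> reduced_on W o i].
Proof.
suff: forall n, exists W o, [/\ lin_equiv D W, ordering o
    & forall i, (height - n < i)%N -> (0 < i <= height)%N -> reduced_on W o i].
  move=> /(_ height)[W [o [eqDW oP red]]]; exists W, o; split=> // i i_in.
  by apply: red => //; lia.
elim=> [|n [W [o [eqDW oP red]]]].
  exists D, layer_seq; split; [exact: lin_equivxx|exact: ordering_layer|by move=> i; lia].
have [le_hn|lt_nh] := leqP height n.
  by exists W, o; split=> // i _ i_in; apply: red => //; lia.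
have i_in : (0 < height - n <= height)%N by lia.
have [d [[W' xs eqW xsP sameW _ def_d] cyc_d d_le0 _ head_d]] := layer_state_reduced W i_in.
exists W', (update o (height - n)%N xs); split; first exact: lin_equiv_trans eqW.
  exact: ordering_update.
move=> i gt_i lt_i; rewrite /reduced_on /update; case: eqP => [->|ne_i].
  by rewrite -def_d.
have -> : excess i W' (o i) = excess i W (o i); last by apply: red => //; lia.
apply/eq_in_map => x; rewrite (mem_ordering _ _ oP) => /eqP lx.
rewrite sameW ?lx //; first by apply/eqP.
by apply/eqP => def_x; move: lx gt_i; rewrite def_x lay_hub; lia.
Qed.

Lemma reduced_bounds W o i x :
  ordering o -> reduced_on W o i -> (0 < i)%N -> lay x = i -> 0 <= W x <= nu o x.
Proof.
move=> oP [cyc_d d_le0 head_d] i_gt0 lx.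
have x_in : x \in o i by rewrite (mem_ordering _ _ oP) lx.
have def_W : W x = nth 0 (excess i W (o i)) (index x (o i)) + (below i + index x (o i))%N%:Z.
  by rewrite nth_excess ?index_mem ?uniq_ordering // ?nth_index //  ?subrK.
have lt_x : (index x (o i) < size (excess i W (o i)))%N by rewrite size_map index_mem.
have ge_nth j : (j < size (excess i W (o i)))%N ->
    head 0 (excess i W (o i)) - j%:Z <= nth 0 (excess i W (o i)) j.
  elim: j => [|j IHj] lt_j; first by rewrite nth0 subr0.
  have /(sortedP 0)/(_ j lt_j) := quasicyclic_sorted cyc_d.
  by have := IHj (ltnW lt_j); rewrite /slow; lia.
have := ge_nth _ lt_x; have /(all_nthP 0)/(_ _ lt_x) /= := d_le0.
rewrite /nu /place lx; have -> : (i == 0%N) = false by lia.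
by rewrite def_W; move: head_d; set h := head 0 _; set y := nth 0 _ _; move: h y => h y; lia.
Qed.

(** ** The rank criterion *)

Lemma sum_below_place o i : ordering o ->
  \sum_(x | (lay x < i)%N) (place o x)%:Z = 'C(below i, 2)%:Z.
Proof.
move=> oP; elim: i => [|i IHi]; first by rewrite big1 // below0.
have := @sum_excess i 0 _ (oP i); rewrite big1 => [|x _]; last by rewrite ffunE.
rewrite below_sumS IHi (big_ordering i _ oP) big_map.
rewrite [in X in _ -> X](eq_big_seq (fun x => (below i + index x (o i))%N%:Z)); last first.
  by move=> x; rewrite (mem_ordering _ _ oP) /place => /eqP ->.
under eq_bigr => x _ do rewrite ffunE sub0r.
by rewrite sumrN; move: (\sum_(_ <- _) _) => S; lia.
Qed.

Lemma sum_nu o : ordering o -> \sum_x nu o x = 'C(#|G|, 2)%:Z - 1.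
Proof.
move=> oP; rewrite sumrB -below_height -(sum_below_place _ oP).
congr (_ - _); first by apply: eq_bigl => x; rewrite ltnS lay_le.
rewrite (bigD1 root) //= lay_hub0 eqxx big1 ?addr0 // => x.
by rewrite -lay_eq0 => /negPf->.
Qed.

(** If [D - E] has no effective representative then its reduced
    representative lies below some [nu o], at cost at most [deg E] for [D]. *)
Lemma cost_rank_test D r :
  (forall W o, lin_equiv D W -> ordering o -> r%:Z < \sum_x cost o W x) ->
  rank_test D r.
Proof.
move=> lt_cost E E_ge0 degE; have [W [o [eqW oP red]]] := reduced_exists (D - E).
have W_bounds x : x != root -> 0 <= W x <= nu o x.
  rewrite -lay_eq0 => lx_gt0; apply: (reduced_bounds oP (red (lay x) _)) => //; last by lia.
  by have := lay_le Q x; lia.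
have [W0_ge0|W0_lt0] := leP 0 (W root).
  exists W => // x; have [->//|/W_bounds] := eqVneq x root.
  by case/andP.
have le_nu x : W x <= nu o x.
  have [->|/W_bounds/andP[]//] := eqVneq x root.
  by rewrite nu_root //; move: (W root) W0_lt0; lia.
have := lt_cost (W + E) o _ oP; rewrite -degE ltNge => /(_ _)/negP[].
  by rewrite -(subrK E D); apply: lin_equivD2r.
apply: ler_sum => x _; rewrite /cost /pospart ffunE ge_max E_ge0 andbT.
by rewrite lerBlDr addrC lerD2l.
Qed.

(** The total cost is at least [deg W - \sum_x nu o x]. *)
Lemma riemann D r : 'C(#|G|, 2)%:Z + r%:Z <= deg D -> rank_test D r.
Proof.
move=> le_deg; apply: cost_rank_test => W o eqW oP.
have : \sum_x (W x - nu o x) <= \sum_x cost o W x.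
  by apply: ler_sum => x _; rewrite /cost /pospart le_max lexx.
rewrite sumrB sum_nu // -/(deg W) (lin_equiv_deg eqW).
by move: (\sum_x _) => S; move: (deg D) le_deg => d; lia.
Qed.

(** ** Upper bound on the rank *)

(** Induction on the layers, from the top layer [i] down.  Write [k] and [T] for
    the numbers of vertices up to layer [i] and strictly below it, and
    [p = k - l - 1].  Balance the excesses of the layer: its [s] positive
    entries have sum [P <= l + ... + (l - s + 1)], its [sn] negative ones sum to
    [- N] with [N <= p + ... + (p - sn + 1)].  The layer costs [P], so
    [r' = r - P] is left for the layers below, and
    [C(l - s + 1, 2) <= r'] since the bound on [P] is
    [C(l + 1, 2) - C(l - s + 1, 2)].  The degree left below is that of [D] minus
    [P - N + C(k, 2) - C(T, 2)].  The bound on [N] and the inequality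
    [T - (l - s) <= p + 1 - sn], which holds as the layer has at least [s + sn]
    vertices, show that the induction hypothesis applies with [r'] and
    [l - s]. *)
Lemma cheap_representative i D (r l : nat) o :
  (i <= height)%N -> ordering o -> ('C(l.+1, 2) <= r)%N ->
  \sum_(x | (lay x < i.+1)%N) D x
    < r%:Z + 'C(below i.+1, 2)%:Z - 'C(below i.+1 - l, 2)%:Z ->
  exists W o', [/\ lin_equiv D W, ordering o',
    forall x, (i < lay x)%N -> W x = D x, forall j, (i < j)%N -> o' j = o j
    & \sum_(x | (lay x < i.+1)%N) cost o' W x <= r%:Z].
Proof.
elim: i D r l o => [|i IHi] D r l o le_i oP le_lr.
  rewrite below_sumS big_pred0_eq add0r => ltD.
  exists D, o; split=> //; first exact: lin_equivxx.
  rewrite below_sumS big_pred0_eq add0r; move: ltD.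
  rewrite !(big_pred1 root) => [|x|x]; rewrite ?lay_eq0 // below1.
  rewrite /cost nu_root // /pospart bin_small // (@bin_small (1 - l)); last by lia.
  by move: (D root); lia.
(* For [l >= k - 1] the last binomial coefficient vanishes, so [l = k - 1] gives
   the same bound on the degree. *)
wlog le_l : l le_lr / (l < below i.+2)%N.
  move=> IHl; have [|le_kl] := ltnP l (below i.+2); first exact: IHl.
  have k_gt0 : (0 < below i.+2)%N by apply: below_gt0.
  move=> ltD; apply: (IHl (below i.+2).-1); rewrite ?prednK //.
    by apply: leq_trans le_lr; apply: leq_bin2; lia.
  move: ltD; rewrite (@bin_small (_ - l)) ?(@bin_small (_ - _.-1)) //; lia.
move=> ltD; have i_in : (0 < i.+1 <= height)%N by [].
have T_gt0 : (0 < below i.+1)%N by apply: below_gt0.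
have step x d : layer_state D i.+1 (x :: d) ->
    layer_state D i.+1 (rcons d (x + (below i.+1).+1%:Z)) by apply: layer_state_step.
have [d0 [Sd0 cyc_d0 d0_le0 size_d0 _]] := layer_state_reduced D i_in.
have def_k := belowS i.+1; rewrite -size_d0 in def_k.
pose p := (below i.+2 - l.+1)%N.
have [||d [Sd cyc_d size_d [le_s le_sn] [last_d head_d]]] :=
    rotate_to_balanced (l := l) (p := p) step T_gt0 _ _ Sd0 cyc_d0 d0_le0.
- by rewrite size_d0 layer_gt0.
- by rewrite -def_k /p; lia.
set s := count _ d in le_s last_d head_d; set sn := count _ d in le_sn.
have le_q : (s + sn <= size d0)%N by rewrite -size_d count_pos_neg.
set P : int := \sum_(y <- d) pospart y; set N : int := \sum_(y <- d) pospart (- y).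
have leP_ : P <= ((l - s) * s + 'C(s.+1, 2))%N%:Z.
  have := sum_pospart_le (M := (l - s)%N%:Z) _ _ (quasicyclic_sorted cyc_d).
  rewrite -/s -/P => /(_ isT); rewrite PoszD PoszM mulrC; apply.
  by move: (last 0 d) last_d; lia.
have leN : N <= ((p - sn) * sn + 'C(sn.+1, 2))%N%:Z.
  have := sum_negpart_le (M := (p - sn)%N%:Z) _ _ (quasicyclic_sorted cyc_d).
  rewrite -/sn -/N => /(_ isT); rewrite PoszD PoszM mulrC; apply.
  by move: (head 0 d) head_d; rewrite /p; lia.
case: Sd => W xs eqW xsP sameW degW def_d.
have P_ge0 : 0 <= P by apply: sumr_ge0 => y _; rewrite /pospart; lia.
have sum_W := sum_excess W xsP; rewrite -def_d sum_pos_neg -/P -/N in sum_W.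
have binL := bin2D (l - s).+1 s; rewrite addSn subnK // in binL.
have binP := bin2D (p - sn).+1 sn; rewrite addSn subnK // in binP.
have [r' def_r'] : exists r' : nat, r%:Z = P + r'%:Z.
  exists (absz (r%:Z - P)%R); have : P <= r%:Z; last by lia.
  apply: le_trans leP_ _; rewrite lez_nat; apply: leq_trans le_lr.
  by rewrite binL binS2 mulSn; lia.
have le_r' : ('C((l - s).+1, 2) <= r')%N.
  by move: leP_ le_lr; rewrite binL binS2 mulSn; lia.
have [||W' [o' [eqW' oP' sameW' same_o' le_cost]]] :=
    IHi W r' (l - s)%N (update o i.+1 xs) (ltnW le_i) _ le_r'.
- exact: ordering_update.
- have lebin : ('C(below i.+1 - (l - s), 2) <= 'C((p - sn).+1, 2))%N.
    by apply: leq_bin2; rewrite /p def_k; lia.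
  rewrite binS2 in lebin.
  have def_p : (below i.+2 - l = p.+1)%N by rewrite /p; lia.
  move: degW ltD leN; rewrite def_p below_sumS sum_W binP mulSn !binS2.
  by move: (\sum_(x | _) D x) (\sum_(x | _) W x) => SD SW; lia.
exists W', o'; split=> //; first exact: lin_equiv_trans eqW'.
- move=> x lt_x; rewrite sameW' ?(ltnW lt_x) // sameW //.
    by rewrite gtn_eqF.
  by apply/eqP => def_x; move: lt_x; rewrite def_x lay_hub; lia.
- by move=> j lt_j; rewrite same_o' ?(ltnW lt_j) // /update gtn_eqF.
rewrite below_sumS layer_cost // same_o' // /update eqxx.
rewrite (_ : excess _ W' xs = d); first by rewrite -/P def_r' addrC lerD2l.
rewrite def_d; apply/eq_in_map => x; rewrite (perm_mem xsP) mem_layer => /eqP lx.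
by rewrite sameW' // lx.
Qed.

Lemma deg_lower_bound D (r l : nat) :
  rank_test D r -> ('C(l.+1, 2) <= r)%N ->
  r%:Z + 'C(#|G|, 2)%:Z - 'C(#|G| - l, 2)%:Z <= deg D.
Proof.
move=> testD le_lr; rewrite leNgt; apply/negP => ltD.
have [|W [o [eqW oP _ _ le_cost]]] :=
    @cheap_representative height D r l layer_seq (leqnn _) ordering_layer le_lr.
  by rewrite below_height; under eq_bigl => x do rewrite ltnS lay_le.
have := rank_test_cost testD eqW oP; rewrite ltNge => /negP; apply.
by move: le_cost; under eq_bigl => x do rewrite ltnS lay_le.
Qed.

(** ** The hyperplane class *)

(** The analogue of the class of a line on a smooth plane curve of degree
    [#|G| + 1]: degree, genus, ranks of the multiples and canonical multiple
    agree. *)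
Definition hyperplane : divisor G := [ffun x => 1 + (x == root)%:Z].

Lemma deg_hyperplane : deg hyperplane = #|G|.+1%:Z.
Proof.
rewrite /deg; under eq_bigr => x _ do rewrite ffunE.
rewrite big_split /= sumr_const natz (bigD1 root) //= eqxx big1 => [|x /negPf-> //].
by rewrite addr0 addrC.
Qed.

(** Write a representative of [l H] as [l H + script_div g].  On layer [i + 1] the
    numbers [W x - place x] are [z i + modulus (i + 1) * a x - place x], where
    [z i] is [l] plus the sum of [g] over layer [i + 1], and the sum of [a] over
    that layer is [z (i + 1) - z i].  By induction the layers up to [i] cost at
    least as much as a staircase going down from [z i + 1], and [staircase_layer]
    passes from one layer to the next.  At the top [z = l]. *)
Lemma hyperplane_rank l : (l <= #|G|)%N ->
  rank_test (hyperplane *+ l) ('C(l.+2, 2) - 1).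
Proof.
move=> le_l; apply: cost_rank_test => W o /lin_equiv_scriptP[g g0 defW] oP.
have W_E x : W x = l%:Z + l%:Z * (x == root)%:Z + layer_sum g (lay x)
    - modulus (lay x) * g x
    + (x == hub (lay x))%:Z * (modulus (lay x) * layer_sum g (lay x).+1).
  by rewrite defW !ffunE ffunMnE ffunE -mulr_natl natz mulrDr mulr1 -!addrA.
pose z i : int := l%:Z + layer_sum g i.+1.
have key i : (i <= height)%N ->
    staircase (below i.+1) (z i) <= \sum_(x | (lay x < i.+1)%N) cost o W x.
  elim: i => [|i IHi] le_i.
    rewrite below_sumS big_pred0_eq add0r (big_pred1 root) => [|x]; last by rewrite lay_eq0.
    rewrite below1 staircaseS /staircase big_ord1 /cost nu_root // W_E lay_hub0 !eqxx.
    have -> : layer_sum g 0 = 0.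
      by rewrite /layer_sum (big_pred1 root) => [|x]; rewrite ?lay_eq0.
    rewrite g0 /modulus below1 /z /pospart /=; move: (layer_sum g 1) => L; lia.
  have T_le := IHi (ltnW le_i).
  rewrite below_sumS; apply: le_trans (lerD T_le (lexx _)).
  have size_o : size (o i.+1) = size (layer_seq i.+1) by apply: perm_size.
  pose a (j : 'I_(size (layer_seq i.+1))) := - g (nth root (o i.+1) j)
    + (nth root (o i.+1) j == hub i.+1)%:Z * layer_sum g i.+2.
  have sum_o (F : G -> int) : \sum_(j < size (layer_seq i.+1)) F (nth root (o i.+1) j)
      = \sum_(x | lay x == i.+1) F x.
    by rewrite (big_ordering i.+1 _ oP) (big_nth root) big_mkord size_o.
  have sum_a : z i + \sum_j a j = z i.+1.
    rewrite (sum_o (fun x => - g x + (x == hub i.+1)%:Z * layer_sum g i.+2)).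
    rewrite big_split /= sumrN -/(layer_sum g i.+1) -big_distrl /=.
    rewrite (bigD1 (hub i.+1)) ?lay_hub //= eqxx big1 => [|x /andP[_ /negPf->]] //.
    by rewrite /z addr0 mul1r; ring.
  have := staircase_layer (below i.+1) (z i) a; rewrite sum_a -belowS => le_stair.
  apply: le_trans le_stair _; rewrite lerD2l -sum_o le_eqVlt; apply/predU1P; left.
  apply: eq_bigr => j _; rewrite /cost /nu /place.
  have lx : lay (nth root (o i.+1) j) = i.+1.
    by apply/eqP; rewrite -(mem_ordering _ _ oP) mem_nth ?size_o.
  rewrite W_E lx index_uniq ?size_o ?(uniq_ordering _ oP) // subr0.
  have -> : (nth root (o i.+1) j == root) = false by rewrite -lay_eq0 lx.
  by congr pospart; rewrite /a /z /modulus mulr0 addr0; ring.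
have := key height (leqnn _); rewrite below_height.
have -> : z height = l.+1%:Z - 1.
  rewrite /z /layer_sum big1 => [|x /eqP lx]; first by lia.
  by have := lay_le Q x; rewrite lx ltnn.
rewrite staircase_small //; under eq_bigl => x do rewrite ltnS lay_le.
have : (0 < 'C(l.+2, 2))%N by rewrite bin_gt0.
by move: (\sum_x _) => S; lia.
Qed.

(** ** The canonical divisor *)

(** The valency is minus the diagonal coefficient of the Laplacian. *)
Lemma valency_layers x : (valency x)%:Z =
  (lay x != 0%N)%:Z * (below (lay x).+1)%:Z
  + (x == hub (lay x))%:Z * (modulus (lay x) * (size (layer_seq (lay x).+1))%:Z).
Proof.
have -> : (valency x)%:Z = - laplacian (point x) x.
  rewrite ffunE /valency raddf_sum -sumrN /=; apply: eq_bigr => y _.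
  rewrite !ffunE eqxx; have [->|_] := eqVneq y x; first by rewrite mult_loopless mul0r.
  by rewrite sub0r mulrN mulr1 opprK.
pose g y := point x y - point x (hub (lay y).-1).
rewrite laplacian_layers ffunE -/g -/(g x).
have sum_g j : layer_sum g j =
    (lay x == j)%:Z - (x == hub j.-1)%:Z * (size (layer_seq j))%:Z.
  rewrite /layer_sum (eq_bigr (fun y => (y == x)%:Z - (x == hub j.-1)%:Z)); last first.
    by move=> y /eqP ly; rewrite /g !ffunE ly (eq_sym x).
  rewrite sumrB sumr_const -mulr_natr natz cardE; congr (_ - _).
  rewrite big_mkcond (bigD1 x) //= eqxx big1 ?addr0 => [|y /negPf->]; last by rewrite if_same.
  by case: eqP.
have -> : g x = 1 - (x == hub (lay x).-1)%:Z by rewrite /g !ffunE eqxx (eq_sym x).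
rewrite !sum_g eqxx (ltn_eqF (ltnSn _)) /modulus; case: (posnP (lay x)) => [lx|lx_gt0].
  rewrite lx -(lay_root lx) eqxx /=; have := belowS 0; rewrite below0 below1 add0n => <-.
  by ring.
have -> : (x == hub (lay x).-1) = false.
  by apply/eqP => /(congr1 lay); rewrite lay_hub; have := lay_le Q x; lia.
have -> : (below (lay x).+1).+1%:Z = (below (lay x).+1)%:Z + 1 by lia.
by case: (x == hub (lay x)) => /=; ring.
Qed.

Lemma canonical_hyperplane :
  lin_equiv (hyperplane *~ (#|G|%:Z - 2)) (canonical_divisor G).
Proof.
apply/lin_equiv_scriptP.
(* The sum of [g] over a layer accounts for the edges inside the layer and down
   from it; the difference between the sums over consecutive layers, which is the
   size of the upper one, accounts for the edges from a hub to the layer above. *)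
pose g x := (x == hub (lay x))%:Z * ((lay x != 0%N)%:Z * ((below (lay x).+1)%:Z - #|G|%:Z)).
exists g; first by rewrite /g lay_hub0 eqxx /= mul0r mulr0.
have sum_g i : layer_sum g i = (0 < i <= height)%N%:Z * ((below i.+1)%:Z - #|G|%:Z).
  have [le_i|lt_i] := leqP i height; last first.
    rewrite andbF mul0r /layer_sum big1 // => x /eqP lx.
    by have := lay_le Q x; rewrite lx leqNgt lt_i.
  rewrite /layer_sum (bigD1 (hub i)) ?lay_hub //= big1 ?addr0; last first.
    by move=> x /andP[/eqP lx /negPf ne_x]; rewrite /g lx ne_x mul0r.
  by rewrite /g lay_hub // eqxx mul1r lt0n andbT.
apply/ffunP => x; rewrite !ffunE ffunMzE ffunE valency_layers !sum_g lay_le andbT /g.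
have [def_x|ne_x] := eqVneq x (hub (lay x)); last first.
  case: (posnP (lay x)) => [/lay_root def_x|lx_gt0].
    by move: ne_x; rewrite {2}def_x lay_hub0 -def_x eqxx.
  by rewrite -lay_eq0 (gtn_eqF lx_gt0) /= -mulrzr intz; ring.
have -> : (size (layer_seq (lay x).+1))%:Z = (below (lay x).+2)%:Z - (below (lay x).+1)%:Z.
  by rewrite belowS; lia.
have -> : (below (lay x).+2)%:Z
    = (lay x < height)%N%:Z * ((below (lay x).+2)%:Z - #|G|%:Z) + #|G|%:Z.
  have := lay_le Q x; rewrite leq_eqVlt => /predU1P[->|->]; last by rewrite mul1r subrK.
  by rewrite ltnn mul0r add0r /card_below; congr Posz; apply: eq_card => y;
     rewrite !inE ltnS leqW ?lay_le.
rewrite -mulrzr intz /modulus -lay_eq0.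
case: (lay x < height)%N; case: (posnP (lay x)) => [->|lx_gt0];
  rewrite /= ?below1 -?[(below _).+1]addn1 ?PoszD; ring.
Qed.

Lemma genus_layers : genus G = 'C(#|G|, 2)%:Z.
Proof.
have := lin_equiv_deg canonical_hyperplane.
rewrite degMz deg_hyperplane /deg; under eq_bigr => x _ do rewrite ffunE.
rewrite sumrB sumr_const -raddf_sum /=.
have card_gt0 := vertex_nonempty G.
move=> eq_val; have : (\sum_(x : G) valency x = #|G| * #|G| + #|G| - 2)%N.
  by move: eq_val; set S := (\sum_(_ : G) _)%N; move: (#|G|) card_gt0 => n n_gt0; nia.
rewrite /genus /num_edges => ->; have := bin2_double #|G|.
move: (#|G|) card_gt0 => n n_gt0; nia.
Qed.

(** ** Uniqueness of the rank-two class *)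

Lemma layer_state_rotate D i d1 d2 : (0 < i <= height)%N ->
  layer_state D i (d1 ++ d2) ->
  layer_state D i (d2 ++ [seq y + (below i).+1%:Z | y <- d1]).
Proof.
move=> i_in; elim: d1 d2 => [|x d1 IHd] d2 /=; first by rewrite cats0.
by move=> /(layer_state_step i_in); rewrite rcons_cat => /IHd; rewrite cat_rcons.
Qed.

Lemma excess_unplace i W xs : uniq xs -> excess i W xs = unplace (below i) [seq W x | x <- xs].
Proof.
move=> uniq_xs; apply: (@eq_from_nth _ 0) => [|j]; rewrite ?size_unplace !size_map // => lt_j.
by rewrite nth_excess // nth_unplace ?size_map // (nth_map root).
Qed.

Lemma sum_below_ones D i : deg D = #|G|.+1%:Z ->
  (forall x, (i <= lay x)%N -> D x = 1) ->
  \sum_(x | (lay x < i)%N) D x = (below i).+1%:Z.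
Proof.
move=> degD D1; have : \sum_x (D x - 1) = 1.
  by rewrite sumrB -/(deg D) degD sumr_const natz -[#|G|.+1]addn1 PoszD; ring.
rewrite (bigID (fun x => lay x < i)%N) /= [X in _ + X]big1 ?addr0; last first.
  by move=> x; rewrite -leqNgt => /D1 ->.
rewrite sumrB sumr_const natz => /eqP; rewrite subr_eq => /eqP ->.
by rewrite -/(below i) -addn1 PoszD addrC.
Qed.

(** A list [e] of cost [P] on layer [i] leaves [2 - P >= r] for the layers below,
    where the divisor has the degree on the right plus [C(below i, 2)].  By
    [cheap_representative] this degree cannot be small, since otherwise the total
    cost would be at most 2. *)
Lemma cheap_layer D i e (r l : nat) :
  rank_test D 2 -> deg D = #|G|.+1%:Z ->
  (0 < i <= height)%N -> (forall x, (i < lay x)%N -> D x = 1) ->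
  layer_state D i e -> ('C(l.+1, 2) <= r)%N ->
  r%:Z + \sum_(y <- e) pospart y <= 2 ->
  r%:Z - 'C(below i - l, 2)%:Z
    <= (below i.+1).+1%:Z - \sum_(y <- e) y - 'C(below i.+1, 2)%:Z.
Proof.
move=> testD degD i_in D1 [W xs eqW xsP sameW degW def_e] le_lr le_2.
rewrite leNgt; apply/negP => lt_r.
case: i i_in D1 xsP sameW degW def_e lt_r => // i /= i_in D1 xsP sameW degW def_e lt_r.
have [||W' [o [eqW' oP sameW' same_o le_cost]]] :=
  @cheap_representative i W r l (update layer_seq i.+1 xs) (ltnW i_in) _ le_lr.
- by apply: ordering_update.
- move: degW; rewrite below_sumS (sum_excess _ xsP) -def_e (sum_below_ones degD D1).
  by move: (\sum_(x | (lay x < i.+1)%N) W x) (\sum_(y <- e) y) lt_r => S S'; lia.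
have := rank_test_cost testD (lin_equiv_trans eqW eqW') oP; rewrite ltNge => /negP; apply.
rewrite (bigID (fun x => lay x < i.+2)%N) /= below_sumS [X in _ + X]big1 ?addr0; last first.
  move=> x; rewrite -leqNgt => lt_x; rewrite /cost /pospart sameW'; last exact: ltnW.
  rewrite sameW ?D1 ?gtn_eqF //; last first.
    by apply/eqP => def_x; move: lt_x; rewrite def_x lay_hub; lia.
  have : (0 < below (lay x))%N by apply: below_gt0; lia.
  by rewrite /nu /place gtn_eqF; lia.
rewrite layer_cost // same_o // /update eqxx.
rewrite (_ : excess _ W' xs = e); first by apply: le_trans le_2; rewrite lerD2r.
rewrite def_e; apply/eq_in_map => x; rewrite (perm_mem xsP) mem_layer => /eqP lx.
by rewrite sameW' // lx.
Qed.

(** Let [w] be the sorted list of values on the layer, above [T] vertices.  If all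
    are positive, [cheap_layer] with [r = 2] shows that their sum is at most their
    number.  If there are zeros, rotating them costs 1, because only the first
    one gets a positive excess, and [cheap_layer] with [r = 1] leaves the case
    [T = 1] of a single zero followed by ones; there, rotating the zero and a one
    costs 2 and contradicts [cheap_layer] with [r = 0]. *)
Lemma layer_ones W o i :
  rank_test W 2 -> deg W = #|G|.+1%:Z -> ordering o -> reduced_on W o i ->
  (0 < i <= height)%N -> (2 < below i.+1)%N ->
  (forall x, (i < lay x)%N -> W x = 1) -> forall x, lay x = i -> W x = 1.
Proof.
move=> testW degW oP red i_in k_gt2 W1.
have T_gt0 : (0 < below i)%N by apply: below_gt0; case/andP: i_in.
have [T def_T] : exists T, below i = T by eexists.
have [k def_k0] : exists k, below i.+1 = k by eexists.
rewrite def_T in T_gt0; rewrite def_k0 in k_gt2.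
have uniq_o := uniq_ordering i oP.
pose w := [seq W x | x <- o i]; have def_d := excess_unplace i W uniq_o.
rewrite -/w def_T in def_d.
have def_k : k = (T + size w)%N by rewrite -def_k0 belowS def_T size_map (perm_size (oP i)).
have [cyc_d d_le0 _] := red; rewrite def_d def_T in cyc_d d_le0.
have srt_w : sorted <=%R w by rewrite -(sorted_unplace T) (quasicyclic_sorted cyc_d).
have w_ge0 : all (>= 0) w.
  apply/allP => _ /mapP[x x_in ->]; rewrite (mem_ordering _ _ oP) in x_in.
  by have /andP[] := reduced_bounds oP red (proj1 (andP i_in)) (eqP x_in).
have state_w : layer_state W i (unplace T w).
  by rewrite -def_d; apply: (@LayerState _ _ _ W (o i)) => //; apply: lin_equivxx.
have sum_d : \sum_(y <- unplace T w) y + 'C(k, 2)%:Z = \sum_(x <- w) x + 'C(T, 2)%:Z.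
  have := sum_excess W (oP i); rewrite def_d def_k0 def_T (big_ordering i _ oP) big_map => ->.
  by rewrite subrK.
have cheap e r l := @cheap_layer W i e r l testW degW i_in W1.
have binT : 'C(T, 2) = ('C(T - 1, 2) + (T - 1))%N.
  by case: (T) T_gt0 => // t _; rewrite subn1 binS2.
suff w1 : all (pred1 1) w.
  by move=> x lx; apply/eqP/(allP w1)/map_f; rewrite (mem_ordering _ _ oP) lx.
have [n [w' [def_w w'_ge1]]] := sorted_zeros srt_w w_ge0.
have sum_w' := sum_ge_size w'_ge1.
have sum_w : \sum_(x <- w) x = \sum_(x <- w') x.
  by rewrite def_w big_cat /= big1_seq ?add0r // => x /andP[_ /nseqP[]].
have size_w : size w = (n + size w')%N by rewrite def_w size_cat size_nseq.
case: n => [|n] in def_w size_w.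
  rewrite def_w; apply: all_eq1 => //=; rewrite -sum_w.
  have := cheap _ 2%N 1%N state_w isT; rewrite sum_pospart0 // def_T def_k0 => /(_ isT).
  move: sum_d size_w; move: (\sum_(y <- unplace T w) y) (\sum_(x <- w) x) => S S'.
  by lia.
have := state_w; rewrite {1}def_w unplace_cat => /(layer_state_rotate i_in).
rewrite def_T; set e := _ ++ _ => state_e.
have := d_le0; rewrite def_w unplace_cat all_cat => /andP[_ w'_le0].
have pos_e : \sum_(y <- e) pospart y = 1.
  rewrite big_cat sum_pospart0 //= big_cons sum_pospart0 ?unplace_zeros_le0 //.
  by rewrite /pospart; lia.
have sum_e : \sum_(y <- e) y = \sum_(y <- unplace T w) y + n.+1%:Z * T.+1%:Z.
  by rewrite /e def_w unplace_cat !big_cat sum_shift size_unplace size_nseq /=; ring.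
have := cheap e 1%N 1%N state_e isT; rewrite pos_e def_T def_k0 sum_e => /(_ isT) le1.
have [n0 T1] : n = 0%N /\ T = 1%N.
  move: le1 sum_d sum_w' size_w; rewrite -sum_w.
  by move: (\sum_(y <- unplace T w) y) (\sum_(x <- w) x) => S S'; nia.
have w'1 : all (pred1 1) w'.
  apply: all_eq1 => //; move: le1 sum_d sum_w' size_w; rewrite -sum_w n0.
  by move: (\sum_(y <- unplace T w) y) (\sum_(x <- w) x) => S S'; lia.
case: w' w'1 def_w size_w sum_w w'_le0 {w'_ge1 sum_w' sum_e pos_e state_e e le1} => [|y w''] /=.
  by lia.
case/andP=> /eqP-> w''1 def_w size_w sum_w; rewrite n0 T1 /= => w''_le0.
move: state_w; rewrite {1}def_w n0 T1 /= => /(@layer_state_rotate _ _ [:: _; _] _ i_in) /=.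
rewrite def_T T1; set e := _ ++ _ => state_e.
have pos_e : \sum_(y <- e) pospart y = 2.
  by rewrite big_cat sum_pospart0 //= !big_cons big_nil /pospart; lia.
have sum_e : \sum_(y <- e) y = \sum_(y <- unplace T w) y + 4.
  by rewrite def_w n0 T1 /e !big_cat /= !big_cons big_nil; ring.
have := cheap e 0%N 0%N state_e isT; rewrite pos_e def_T def_k0 sum_e => /(_ isT).
have sum_w'' : \sum_(x <- w) x = (size w'').+1%:Z.
  by rewrite sum_w big_cons sum_all1.
rewrite {}sum_w'' in sum_d.
have bin_T : 'C(T, 2) = 0%N by rewrite T1.
rewrite subn0 bin_T; move: sum_d; rewrite bin_T.
by move: (\sum_(y <- unplace T w) y) size_w; rewrite n0 /= => S; lia.
Qed.

(** The values 3, 0, 1, 1, ... that escape [layer_ones] when layer 1 is a single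
    vertex.  Moving on a vertex [h] of layer 2 and then twice on layer 1 gives
    -1 at the root, 1 on layer 1, [modulus 2] at [h], 0 on the rest of layer 2
    and 1 above.  With [h] last in its layer, its place is [modulus 2 - 2], and
    the total cost is 2. *)
Lemma not_rank2_bottom W :
  rank_test W 2 -> (1 < height)%N -> below 2 = 2%N ->
  (forall x, (1 < lay x)%N -> W x = 1) -> W (hub 1) = 0 -> W root = 3 -> False.
Proof.
move=> testW height_gt1 below2 W1 Wu Wr.
have layer1 x : (lay x == 1%N) = (x == hub 1).
  have : hub 1 \in layer_seq 1 by apply: layer_hub; apply: ltnW.
  have := belowS 1; rewrite below2 below1 => -[]; rewrite -mem_layer.
  by case: (layer_seq 1) => [|y []] //= _; rewrite !inE => /eqP->.
have size2 := belowS 2; rewrite below2 in size2.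
case def_l: (layer_seq 2) (layer_gt0 height_gt1) => [//|h t] _.
have /andP[h_t uniq_t] : uniq (h :: t) by rewrite -def_l enum_uniq.
have lh : lay h = 2%N by apply/eqP; rewrite -mem_layer def_l mem_head.
pose a x : int := (x == h)%:Z; pose b (x : G) : int := 2.
have in2 : (0 < 2 <= height)%N by [].
have in1 : (0 < 1 <= height)%N by apply: ltnW.
have sum_a : layer_sum a 2 = 1.
  rewrite /layer_sum (bigD1 h) ?lh //= /a eqxx big1 ?addr0 // => y.
  by case/andP=> _ /negPf->.
have sum_b : layer_sum b 1 = 2.
  by rewrite /layer_sum (eq_bigl _ _ layer1) big_pred1_eq.
have eqW : lin_equiv W (W + layer_move 2 a + layer_move 1 b).
  by apply: lin_equiv_trans (lin_equiv_move _ _ in2) (lin_equiv_move _ _ in1).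
pose o := update layer_seq 2 (rcons t h).
have oP : ordering o.
  by apply: ordering_update; [apply: ordering_layer|rewrite def_l perm_rcons].
have := rank_test_cost testW eqW oP; rewrite ltNge => /negP; apply.
have -> : (2%N : int) = \sum_x (x == h)%:Z * 2.
  rewrite (bigD1 h) //= eqxx big1 => [|x /negPf->]; last by rewrite mul0r.
  by rewrite mul1r addr0.
apply: ler_sum => x _.
have nu_ge1 : (0 < lay x)%N -> 1 <= nu o x.
  move=> lx_gt0; have := below_gt0 lx_gt0.
  by rewrite /nu /place (gtn_eqF lx_gt0); lia.
have W'E : (W + layer_move 2 a + layer_move 1 b) x = W x
    + (if lay x == 2%N then modulus 2 * a x - 1 else if lay x == 1%N then - 3 else 0)
    + (if lay x == 1%N then 4 else if lay x == 0%N then - 4 else 0).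
  rewrite layer1 lay_eq0 !ffunE sum_a sum_b /= /modulus below2 below1.
  by rewrite -(layer1 x) -(lay_eq0 x); case: (lay x) => [|[|[|i]]].
rewrite /cost W'E; case lx: (lay x) => [|[|[|i]]] /=.
- by rewrite (lay_root lx) nu_root // Wr /pospart; case: eqP.
- have -> : W x = 0 by rewrite -Wu; congr (W _); apply/eqP; rewrite -layer1 lx.
  by move: nu_ge1; rewrite lx /pospart => /(_ isT); move: (nu o x) => z; case: eqP; lia.
- rewrite W1 ?lx // /a; have [def_x|_] := eqVneq x h; last first.
    by move: nu_ge1; rewrite lx /pospart => /(_ isT); move: (nu o x) => z; lia.
  rewrite def_x /nu /place lh below2 /o /update eqxx -cats1 index_cat (negPf h_t) /=.
  by rewrite eqxx /modulus size2 def_l /pospart /=; lia.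
rewrite W1 ?lx //; move: nu_ge1; rewrite lx /pospart => /(_ isT).
by move: (nu o x) => z; case: eqP; lia.
Qed.

(** The layers are treated from the top down.  Only a bottom layer with a single
    vertex, whose reduced value is 0 or 1, is outside the scope of
    [layer_ones]. *)
Lemma rank2_unique D :
  #|G| <> 2%N -> rank_test D 2 -> deg D = #|G|.+1%:Z -> lin_equiv D hyperplane.
Proof.
move=> ne2 testD degD; have [W [o [eqW oP red]]] := reduced_exists D.
have testW := rank_test_equiv eqW testD.
have degW : deg W = #|G|.+1%:Z by rewrite (lin_equiv_deg eqW).
suff W1 x : (0 < lay x)%N -> W x = 1.
  suff <- : W = hyperplane by [].
  apply/ffunP => x; rewrite ffunE; have [->|ne_x] := eqVneq x root.
    have := sum_below_ones (i := 1) degW W1; rewrite below1 below_sumS big_pred0_eq add0r.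
    by rewrite (big_pred1 root) => [|y]; rewrite ?lay_eq0.
  by rewrite W1 ?addr0 // lt0n lay_eq0.
suff main n : forall y, (0 < lay y)%N -> (height - n < lay y)%N -> W y = 1.
  by move=> lx_gt0; apply: (main height) => //; rewrite subnn.
elim: n => [|n IHn] y ly_gt0 lt_y.
  by have := lay_le Q y; rewrite leqNgt; move: lt_y; rewrite subn0 => ->.
have [/IHn->//|le_y] := ltnP (height - n) (lay y).
have W_above z : (lay y < lay z)%N -> W z = 1 by move=> lt_z; apply: IHn; lia.
have y_in : (0 < lay y <= height)%N by rewrite ly_gt0 lay_le.
have [k_gt2|k_le2] := ltnP 2 (below (lay y).+1).
  exact: (layer_ones testW degW oP (red _ y_in) y_in k_gt2 W_above).
have height_gt0 : (0 < height)%N by case/andP: y_in; apply: leq_trans.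
have size1 := layer_gt0 height_gt0.
have def_b2 := belowS 1; rewrite below1 in def_b2.
have ly1 : lay y = 1%N.
  have [lt1|] := ltnP 1 (lay y); last by lia.
  have := leq_below (lt1 : 1 < (lay y))%N; have := belowS (lay y).
  by have := layer_gt0 (lay_le Q y); lia.
rewrite ly1 in y_in k_le2 W_above.
have below2 : below 2 = 2%N by lia.
have height_gt1 : (1 < height)%N.
  rewrite ltn_neqAle height_gt0 andbT; apply: contra_notN ne2 => /eqP h1.
  by rewrite -below_height -h1.
have def_y : y = hub 1.
  have y_l : y \in layer_seq 1 by rewrite mem_layer ly1.
  have := layer_hub height_gt0; move: y_l def_b2; rewrite below2.
  by case: (layer_seq 1) => [|z []] //=; rewrite !inE => /eqP-> _ /eqP->.
have sum_low := sum_below_ones (i := 2) degW W_above.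
have Wy : W y = 0 \/ W y = 1.
  have := reduced_bounds oP (red _ y_in) isT ly1.
  rewrite /nu /place ly1 below1 /=.
  have size_o1 : size (o 1%N) = 1%N.
    by apply/eqP; rewrite (perm_size (oP 1%N)) -(eqn_add2l 1) -def_b2 below2.
  have : (index y (o 1%N) < 1)%N.
    by rewrite -[X in (_ < X)%N]size_o1 index_mem (mem_ordering _ _ oP) ly1.
  by move: (W y); lia.
case: Wy => // Wy; exfalso; apply: (not_rank2_bottom testW) => //.
  by rewrite -def_y.
move: sum_low; rewrite !below_sumS big_pred0_eq add0r.
rewrite (big_pred1 root) => [|z]; last by rewrite lay_eq0.
rewrite (big_pred1 y) => [|z]; first by rewrite Wy below2 addr0.
have z_l := mem_layer 1 z; have y_l := mem_layer 1 y; rewrite ly1 eqxx in y_l.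
rewrite -z_l; move: y_l def_b2; rewrite below2.
by case: (layer_seq 1) => [|v []] //=; rewrite !inE => /eqP<-.
Qed.

(** ** The gonality sequence *)

(** Attaining the lower bound for [r] also fixes the rank, since the bound for a
    larger rank is larger. *)
Lemma realises_of_deg D r l :
  rank_test D r -> ('C(l.+1, 2) <= r)%N ->
  deg D = r%:Z + 'C(#|G|, 2)%:Z - 'C(#|G| - l, 2)%:Z -> realises_gonality r D.
Proof.
move=> testD le_lr degD; have rankD : is_rank D r%:Z.
  split=> // [|s testD_s]; last first.
    rewrite leqNgt; apply/negP => lt_rs.
    have := deg_lower_bound (rank_testW lt_rs testD_s) (leqW le_lr).
    by rewrite degD; lia.
  have [||E E_ge0 eqE] := rank_testW (leq0n r) testD (E := 0).
  - by move=> x; rewrite ffunE.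
  - by rewrite /deg big1 // => x _; rewrite ffunE.
  by exists E; rewrite // -[D]subr0.
split=> //; split; first by exists D.
by move=> D' [_ testD' _]; rewrite degD; apply: deg_lower_bound.
Qed.

Lemma degM_hyperplane l : (l <= #|G|)%N ->
  (l * #|G|.+1)%N%:Z
    = ('C(l.+2, 2) - 1)%N%:Z + 'C(#|G|, 2)%:Z - 'C(#|G| - l, 2)%:Z.
Proof.
move=> le_l; have := bin2D l (#|G| - l); rewrite subnKC //.
have [t def_t] : exists t, (#|G| - l)%N = t by eexists.
have -> : #|G| = (l + t)%N by lia.
by rewrite addKn !binS2; have := bin2_double l; case: (l) => [|j] /=; lia.
Qed.

Lemma hyperplane_multiple_realises D l : lin_equiv D hyperplane -> (1 <= l <= #|G|)%N ->
  realises_gonality (l * (l + 3))./2 (D *+ l).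
Proof.
move=> eqD /andP[l_gt0 le_l]; rewrite triangle_half; apply: (realises_of_deg (l := l)).
- apply: rank_test_equiv (hyperplane_rank le_l); rewrite !pmulrn.
  by apply: lin_equivMz; apply: lin_equiv_sym.
- by rewrite [in leqRHS]binS2; lia.
by rewrite degMn -(lin_equiv_deg eqD) deg_hyperplane -degM_hyperplane // -mulr_natl natz.
Qed.

Lemma gonality_special l h : (1 <= l <= #|G|)%N -> (h <= l)%N ->
  is_gonality G ((l * (l + 3))./2 - h) (l * (#|G| + 1) - h)%N%:Z.
Proof.
move=> /andP[l_gt0 le_l] le_h; rewrite triangle_half addn1.
have le_hl : (h <= 'C(l.+2, 2) - 1)%N by rewrite !binS2; lia.
have testD : rank_test (hyperplane *+ l - point root *+ h) ('C(l.+2, 2) - 1 - h).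
  by apply: rank_testB; rewrite subnK //; apply: hyperplane_rank.
have degD : deg (hyperplane *+ l - point root *+ h) = (l * #|G|.+1 - h)%N%:Z.
  rewrite -subzn; last by apply: leq_trans le_h (leq_pmulr _ _).
  by rewrite degB !degMn deg_hyperplane deg_point natz -[_ *+ l]mulr_natl natz.
have [_] : realises_gonality ('C(l.+2, 2) - 1 - h) (hyperplane *+ l - point root *+ h).
  apply: (realises_of_deg (l := l)) testD _ _; first by rewrite [in leqRHS]binS2; lia.
  rewrite degD -subzn; last by apply: leq_trans le_h (leq_pmulr _ _).
  by rewrite degM_hyperplane // -(subzn le_hl); ring.
by rewrite degD.
Qed.

Lemma gonality_nonspecial r D :
  ('C(#|G|, 2) <= r)%N -> deg D = 'C(#|G|, 2)%:Z + r%:Z -> realises_gonality r D.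
Proof.
have G_gt0 := vertex_nonempty G; move=> le_r degD.
apply: (realises_of_deg (l := #|G|.-1)); rewrite ?prednK //.
  by apply: riemann; rewrite degD.
by rewrite (@bin_small (_ - _)); [rewrite degD; lia|lia].
Qed.

End Layered.

(** * Quasi-banana graphs are layered *)

Lemma layering_isomorphic (G H : multigraph) :
  isomorphic G H -> layering H -> inhabited (layering G).
Proof.
case=> f [e fK eK] multf Q.
have card_lay i : card_below (fun x => lay Q (f x)) i = card_below (lay Q) i.
  rewrite /card_below -!sum1_card (reindex f) //=; last by exists e => x _.
constructor; apply: (@Layering G (height Q) (fun x => lay Q (f x)) (fun i => e (hub Q i))).
- by move=> x; apply: lay_le.
- by move=> i le_i; rewrite eK lay_hub.
- by move=> x /lay_root def_x; rewrite -def_x fK.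
move=> x y /=; rewrite -multf (mult_lay Q) !card_lay (inj_eq (can_inj fK)).
by rewrite !(can2_eq fK eK).
Qed.

Section QuasiBananaLayers.

Variables (m : nat) (N : m.-tuple nat).
Hypothesis posN : all (leq 1) N.

Let first (i : nat) : QB posN :=
  odflt (qb_root N) [pick x | (layer x == i) && (pos x == 0%N)].

Lemma firstP i : (i <= m)%N -> layer (first i) = i /\ pos (first i) = 0%N.
Proof.
rewrite /first => le_i; case: pickP => [x /andP[/eqP-> /eqP->] //|none].
by have [x lx px] := qb_first posN le_i; have := none x; rewrite lx px !eqxx.
Qed.

(** Vertices are pairs of a layer and a position, so the count is a sum over
    pairs. *)
Lemma card_layers i : (i <= m.+1)%N ->
  @card_below (QB posN) (@layer m N) i = (\sum_(0 <= k < i) qb_size N k)%N.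
Proof.
move=> le_i; rewrite /card_below -sum1_card big_mkord (big_ord_widen m.+1) //.
under [RHS]eq_bigr => k _ do rewrite -[qb_size N k]card_ord -sum1_card.
rewrite (@sig_big_dep _ _ addn _ (fun k : 'I_m.+1 => 'I_(qb_size N k))
  (fun k => k < i)%N (fun _ _ => true) (fun _ _ => 1%N)).
by apply: eq_bigl => x; rewrite andbT.
Qed.

Lemma qb_layering : layering (QB posN).
Proof.
have layer_le (x : QB posN) : (layer x <= m)%N by rewrite -ltnS ltn_ord.
have pos_lt (x : QB posN) : (pos x < qb_size N (layer x))%N := ltn_ord (tagged x).
have pos0 (x : QB posN) : (pos x == 0%N) = (x == first (layer x)).
  have [ly py] := firstP (layer_le x).
  by apply/eqP/eqP => [px|->] //; apply: qb_vertex_inj; rewrite ?ly ?py.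
refine (@Layering (QB posN) m (@layer m N) first layer_le _ _ _).
- by move=> i /firstP[].
- move=> x lx; rewrite -lx; apply/eqP; rewrite -pos0 -leqn0 -ltnS.
  by have := pos_lt x; rewrite lx.
move=> x y up /=; rewrite /qb_mult; case: eqVneq => // _.
have upE (u v : QB posN) : up u v = qb_up u v.
  rewrite /up /qb_up -pos0; case: ifP => _; last by rewrite mul0n.
  by rewrite card_layers ?ltnS // big_ltn // mul1n addn2 -add1n.
by rewrite !upE.
Qed.

End QuasiBananaLayers.

Theorem theorem2 (G : multigraph) (k : nat)
    (qbG : quasi_banana G) (gonG : is_gonality G 1 k%:Z) :
  [/\ genus G = 'C(k, 2)%:Z,
      forall r : nat, (1 <= r)%N ->
        (r%:Z < genus G ->
           exists l h : nat,
             [/\ [/\ (1 <= l <= k - 2)%N, (h <= l)%N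
                   & r = ((l * (l + 3))./2 - h)%N],
                 forall l' h' : nat, (1 <= l' <= k - 2)%N -> (h' <= l')%N ->
                   r = ((l' * (l' + 3))./2 - h')%N -> l' = l /\ h' = h
               & is_gonality G r (l * (k + 1) - h)%N%:Z]) /\
        (genus G <= r%:Z -> is_gonality G r (genus G + r%:Z)),
      k <> 2%N -> forall D D' : divisor G,
        realises_gonality 2 D -> realises_gonality 2 D' -> lin_equiv D D'
    & forall D : divisor G, realises_gonality 2 D ->
        (forall l : nat, (1 <= l <= k)%N ->
           realises_gonality (l * (l + 3))./2 (D *+ l)) /\
        lin_equiv (D *~ (k%:Z - 2)) (canonical_divisor G)].
Proof.
have [m [N [posN isoG]]] := qbG.
have [Q] := layering_isomorphic isoG (qb_layering posN).
have k_gt0 := vertex_nonempty G.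
(* [H] minus the root has rank 1, degree [#|G|]. *)
have def_k : k = #|G|.
  have := gonality_special Q (l := 1) (h := 1) k_gt0 isT.
  rewrite (_ : (1 * (#|G| + 1) - 1)%N = #|G|); last by lia.
  by move/(gonality_uniq gonG) => -[].
subst k; rewrite (genus_layers Q).
have gon2 (D : divisor G) : realises_gonality 2 D -> rank_test D 2 /\ deg D = #|G|.+1%:Z.
  move=> [[_ testD _] gonD]; split=> //.
  have := gonality_special Q (l := 1) (h := 0) k_gt0 isT.
  rewrite (_ : (1 * (#|G| + 1) - 0)%N = #|G|.+1); last by lia.
  by move=> gonH; apply: (gonality_uniq gonD gonH).
have unique D : #|G| <> 2%N -> realises_gonality 2 D -> lin_equiv D (hyperplane Q).
  by move=> ne2 /gon2[testD degD]; apply: rank2_unique.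
split=> //.
- move=> r r_gt0; split=> [|le_gr].
    rewrite ltz_nat => lt_rg.
    (* [l] is found from C(l + 1, 2) <= r < C(l + 2, 2). *)
    have [l le_lr lt_rl] : exists2 l, ('C(l.+1, 2) <= r)%N & (r < 'C(l.+2, 2))%N.
      elim: (#|G|) lt_rg => [|n IHn]; first by rewrite bin_small.
      have [lt_rn _|le_nr lt_rn] := ltnP r 'C(n, 2); first exact: IHn.
      by case: n {IHn} le_nr lt_rn => [|n] le_nr lt_rn; [rewrite bin_small in lt_rn|exists n].
    have eq_l l' h' : (h' <= l')%N -> r = ((l' * (l' + 3))./2 - h')%N ->
        l' = l /\ h' = ('C(l.+2, 2) - 1 - r)%N.
      rewrite triangle_half => le_h' def_r.
      have := binS2 l'.+1 => binl'.
      have le_l'l : (l' <= l)%N.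
        rewrite leqNgt; apply/negP => lt_ll'.
        have : ('C(l.+2, 2) <= 'C(l'.+1, 2))%N by apply: leq_bin2.
        by lia.
      have le_ll' : (l <= l')%N.
        rewrite leqNgt; apply/negP => lt_l'l.
        have : ('C(l'.+2, 2) <= 'C(l.+1, 2))%N by apply: leq_bin2.
        by lia.
      have eq_l : l' = l by lia.
      by split=> //; rewrite -eq_l; lia.
    have l_gt0 : (0 < l)%N by case: l lt_rl {le_lr eq_l} => [|l] //; rewrite binn; lia.
    have lt_lk : (l.+1 < #|G|)%N.
      rewrite ltnNge; apply/negP => le_kl.
      have : ('C(#|G|, 2) <= 'C(l.+1, 2))%N by apply: leq_bin2.
      by lia.
    have binl := binS2 l.+1.
    exists l, ('C(l.+2, 2) - 1 - r)%N; split.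
    + by split; rewrite ?triangle_half; lia.
    + by move=> l' h' _; apply: eq_l.
    have -> : is_gonality G r = is_gonality G ((l * (l + 3))./2 - ('C(l.+2, 2) - 1 - r))%N.
      by congr is_gonality; rewrite triangle_half; lia.
    by apply: gonality_special => //; lia.
  pose D := point (hub Q 0) *+ ('C(#|G|, 2) + r)%N.
  have degD : deg D = 'C(#|G|, 2)%:Z + r%:Z.
    by rewrite degMn deg_point natz PoszD.
  by have [_] := gonality_nonspecial Q le_gr degD; rewrite degD.
- move=> ne2 D D' /(unique D ne2) eqD /(unique D' ne2) /lin_equiv_sym.
  exact: lin_equiv_trans.
move=> D gonD; have [testD degD] := gon2 D gonD.
have [eq2|/eqP ne2] := eqVneq #|G| 2%N; last first.
  have eqD := unique D ne2 gonD; split=> [l|]; first exact: hyperplane_multiple_realises eqD.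
  exact: lin_equiv_trans (lin_equivMz _ eqD) (canonical_hyperplane Q).
(* Two vertices: the genus is 1, [D] need not be equivalent to [H], but the
   multiples [D] and [2 D] lie in the range where the rank depends only on the
   degree, and [0 D] is canonical. *)
split; last by have := canonical_hyperplane Q; rewrite eq2 !mulr0z.
move=> l; rewrite eq2 => l_in; have {l_in} : l = 1%N \/ l = 2%N by lia.
by case=> ->; apply: (gonality_nonspecial Q); rewrite ?degMn ?degD eq2 ?binn //.
Qed.
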